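(* Let $\mathbb C$ be a cartesian closed category (with strict cartesian monoidal structure $(\otimes,I)$) with distributive binary coproducts $\oplus$. Then the double functor $D:\ulcorner\mathbb C\urcorner\to\mathsf S(\mathbb C)$, which is the identity on horizontal edges, sends the vertical edges $A^\circ,A^\bullet$ to the strong functors $(-\otimes A)$ and $(-)^A$, sends $\ulcorner f\urcorner$ to $[f]$, and sends corner cells to the corresponding corner cells, extends to a double functor $D:\ulcorner\mathbb C\urcorner^{\oplus}\to\mathsf S(\mathbb C)$ as follows: on the vertical edge monoid, $D(U+W)=DU+DW$ and $D(U\times W)=DU\times DW$; on the new cells, $D(\pi_i)=\pi_i$ and $D(\iota_i)=\iota_i$ for $i=0,1$, $D([\alpha,\beta])=[D(\alpha),D(\beta)]$, $D(\alpha+\beta)=D(\alpha)+D(\beta)$, and $D(\alpha\times\beta)=D(\alpha)\times D(\beta)$.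
   Context: Monoidal structures are strict (including the cartesian product $\otimes$ with terminal object $I$); composites are in diagrammatic order. $\sigma_{A,B}:A\otimes B\to B\otimes A$ is the symmetry; $p_0,p_1$ are product projections, $\langle f,g\rangle$ pairing; $\sigma_0,\sigma_1$ coproduct injections, $[f,g]$ copairing, $f\oplus g=[f\sigma_0,g\sigma_1]$. $X^A$ is the exponential, $\mathsf{ev}^A_X:X^A\otimes A\to X$ evaluation, $\lambda[f]:B\to C^A$ the transpose of $f:B\otimes A\to C$. Distributivity: $[\sigma_0\otimes 1_C,\sigma_1\otimes 1_C]:(A\otimes C)\oplus(B\otimes C)\to(A\oplus B)\otimes C$ has an inverse $\delta^r$, and $[1_C\otimes\sigma_0,1_C\otimes\sigma_1]$ has an inverse $\delta^l$. A single-object double category $\mathbb D$ has a horizontal edge monoid $(\mathbb D_H,\otimes,I)$, a vertical edge monoid $(\mathbb D_V,\otimes,I)$, and for $A,B\in\mathbb D_H$, $U,W\in\mathbb D_V$ a set of cells $(U;A;B;W)$ (left; top; bottom; right boundary). For $\alpha:(U;A;B;V)$ and $\beta:(V;A';B';W)$ there is a horizontal composite $\alpha\mid\beta:(U;A\otimes A';B\otimes B';W)$; for $\alpha:(U;A;C;W)$ and $\beta:(U';C;B;W')$ a vertical composite $\frac{\alpha}{\beta}:(U\otimes U';A;B;W\otimes W')$. Both are associative and unital, with horizontal units $id_U:(U;I;I;U)$ and vertical units $1_A:(I;A;A;I)$, where $id_I=1_I$, $1_{A\otimes B}=1_A\mid 1_B$, $id_{U\otimes W}=\frac{id_U}{id_W}$,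 and interchange holds. A double functor preserves all of this structure strictly. Free cornering and free cornering with choice of $\mathbb A$ (here $\mathbb A=\mathbb C$): $\mathbb A^{\circ\bullet}$ is the free monoid on symbols $A^\circ,A^\bullet$ ($A\in\mathbb A_0$); $\mathbb A^{\circ\bullet}_\oplus$ is the monoid with elements generated by $A^\circ$, $A^\bullet$, $I$, $U\otimes W$, $U\times W$, $U+W$, subject only to associativity and unitality of $\otimes$. $\ulcorner\mathbb A\urcorner$ is the free single-object double category with horizontal edge monoid $(\mathbb A_0,\otimes,I)$, vertical edge monoid $\mathbb A^{\circ\bullet}$, and generating cells and equations (1),(2); $\ulcorner\mathbb A\urcorner^{\oplus}$ is the free single-object double category with the same horizontal edge monoid, vertical edge monoid $\mathbb A^{\circ\bullet}_\oplus$, and generating cells and equations (1)–(5): (1) for each $f:A\to B$ in $\mathbb A$ a cell $\ulcorner f\urcorner:(I;A;B;I)$, with $\ulcorner fg\urcorner=\frac{\ulcorner f\urcorner}{\ulcorner g\urcorner}$, $\ulcorner 1_A\urcorner=1_A$, $\ulcorner f\otimes g\urcorner=\ulcorner f\urcorner\mid\ulcorner g\urcorner$; (2) for each $A\in\mathbb A_0$ corner cells $\mathsf{get}_L^A:(A^\circ;I;A;I)$, $\mathsf{put}_R^A:(I;A;I;A^\circ)$, $\mathsf{get}_R^A:(I;I;A;A^\bullet)$, $\mathsf{put}_L^A:(A^\bullet;A;I;I)$ with $\mathsf{put}_R^A\mid\mathsf{get}_L^A=1_A$, $\frac{\mathsf{get}_L^A}{\mathsf{put}_R^A}=id_{A^\circ}$,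 $\mathsf{get}_R^A\mid\mathsf{put}_L^A=1_A$, $\frac{\mathsf{get}_R^A}{\mathsf{put}_L^A}=id_{A^\bullet}$; (3) for all $U,W$, cells $\pi_0:(U\times W;I;I;U)$, $\pi_1:(U\times W;I;I;W)$, and for $\alpha:(V;A;B;U)$, $\beta:(V;A;B;W)$ a unique cell $\alpha\times\beta:(V;A;B;U\times W)$ with $(\alpha\times\beta)\mid\pi_0=\alpha$, $(\alpha\times\beta)\mid\pi_1=\beta$; (4) for all $U,W$, cells $\iota_0:(U;I;I;U+W)$, $\iota_1:(W;I;I;U+W)$, and for $\alpha:(U;A;B;V)$, $\beta:(W;A;B;V)$ a unique cell $\alpha+\beta:(U+W;A;B;V)$ with $\iota_0\mid(\alpha+\beta)=\alpha$, $\iota_1\mid(\alpha+\beta)=\beta$; (5) for $\alpha:(U;A;C;W)$, $\beta:(U;B;C;W)$ a unique cell $[\alpha,\beta]:(U;A\oplus B;C;W)$ with $\frac{\ulcorner\sigma_0\urcorner}{[\alpha,\beta]}=\alpha$, $\frac{\ulcorner\sigma_1\urcorner}{[\alpha,\beta]}=\beta$. A strong functor $(F,\tau^F):\mathbb C\to\mathbb C$ is a functor with a natural transformation $\tau^F_{X,Y}:FX\otimes Y\to F(X\otimes Y)$ such that $\tau^F_{X,I}=1_{FX}$ and $(\tau^F_{X,Y}\otimes 1_Z)\tau^F_{X\otimes Y,Z}=\tau^F_{X,Y\otimes Z}$. The identity functor has strength $1_{X\otimes Y}$, and $F\circ G$ ($X\mapsto F(G(X))$) has strength $\tau^F_{GX,Y}F(\tau^G_{X,Y})$.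 A strong natural transformation satisfies $(\alpha_X\otimes 1_Y)\tau^G_{X,Y}=\tau^F_{X,Y}\alpha_{X\otimes Y}$. $A^\circ=(-\otimes A)$ has strength $1_X\otimes\sigma_{A,Y}$; $A^\bullet=(-)^A$ has strength $\lambda[(1_{X^A}\otimes\sigma_{Y,A})(\mathsf{ev}^A_X\otimes 1_Y)]$. $\mathsf S(\mathbb C)$ (stateful transformations): horizontal edge monoid $(\mathbb C_0,\otimes,I)$; vertical edge monoid the strong endofunctors under composition $(F,H)\mapsto F\circ H$, with unit $I$ the identity functor; cells $(U;A;B;W)$ are strong natural transformations $A^\circ\circ U\to W\circ B^\circ$, with components $\alpha_X:UX\otimes A\to W(X\otimes B)$; $(\alpha\mid\beta)_X=(\alpha_X\otimes 1_{A'})\beta_{X\otimes B}$ for $\alpha:(F;A;B;G)$, $\beta:(G;A';B';H)$; $(id_F)_X=1_{FX}$; $\left(\frac{\alpha}{\beta}\right)_X=\alpha_{HX}G(\beta_X)$ for $\alpha:(F;A;B;G)$, $\beta:(H;B;C;K)$; $(1_A)_X=1_{X\otimes A}$. For $f:A\to B$, $[f]:(I;A;B;I)$ is $[f]_X=1_X\otimes f$. Corner cells: $(\mathsf{put}_R^A)_X=1_{X\otimes A}$, $(\mathsf{get}_L^A)_X=1_{X\otimes A}$, $(\mathsf{put}_L^A)_X=\mathsf{ev}^A_X$, $(\mathsf{get}_R^A)_X=\lambda[1_{X\otimes A}]$. Choice structure in $\mathsf S(\mathbb C)$: $F\times G$ is $X\mapsto FX\otimes GX$ with strength $\langle p_0\otimes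 1_A,p_1\otimes 1_A\rangle(\tau^F_{X,A}\otimes\tau^G_{X,A})$; $F+G$ is $X\mapsto FX\oplus GX$ with strength $\delta^r(\tau^F_{X,A}\oplus\tau^G_{X,A})$; $\pi_0:(F\times G;I;I;F)$ and $\pi_1:(F\times G;I;I;G)$ have components the projections $p_0,p_1$; $\iota_0:(F;I;I;F+G)$ and $\iota_1:(G;I;I;F+G)$ have components the injections $\sigma_0,\sigma_1$; $(\alpha\times\beta)_X=\langle\alpha_X,\beta_X\rangle$; $(\alpha+\beta)_X=\delta^r[\alpha_X,\beta_X]$; $[\alpha,\beta]_X=\delta^l[\alpha_X,\beta_X]$, for $\alpha,\beta$ of the types in (3),(4),(5). *)

(* Defs.v *)
From Stdlib Require Import List FunctionalExtensionality PropExtensionality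
  ProofIrrelevance ClassicalEpsilon Eqdep.
Import ListNotations.
Set Implicit Arguments.
#[local] Obligation Tactic := idtac.

Record Category := {
  ob :> Type;
  hom : ob -> ob -> Type;
  idm : forall A, hom A A;
  comp : forall A B C, hom A B -> hom B C -> hom A C;
  comp_idl : forall A B (f : hom A B), comp (idm A) f = f;
  comp_idr : forall A B (f : hom A B), comp f (idm B) = f;
  comp_assoc : forall A B C D (f : hom A B) (g : hom B C) (h : hom C D),
    comp (comp f g) h = comp f (comp g h)
}.
Arguments hom {c} A B.
Arguments idm {c} A.
Arguments comp {c A B C} f g.
Arguments comp_idl {c A B} f.
Arguments comp_idr {c A B} f.
Arguments comp_assoc {c A B C D} f g h.

Notation "f ;; g" := (comp f g) (at level 42, left associativity).

(* A morphism together with its endpoints.  [f ≡ g] is equality of morphisms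
   whose endpoints are only propositionally equal; it is what equations of a
   strict structure mean for dependently typed hom-sets. *)
Record Arrow (C : Category) := mkArrow { src : C; tgt : C; mor : hom src tgt }.
Arguments mkArrow {C src tgt} mor.
Notation "f ≡ g" := (mkArrow f = mkArrow g) (at level 70, no associativity).

Definition hcast {C : Category} {A A' B B' : C} (eA : A = A') (eB : B = B')
  (f : hom A B) : hom A' B' :=
  match eA in _ = a, eB in _ = b return hom a b with
  | eq_refl, eq_refl => f
  end.
Arguments hcast : simpl never.

(* Strictness of a cartesian structure: the canonical associativity and unit
   isomorphisms are identities. *)
Record CartCategory := {
  cart_cat :> Category;
  tens : cart_cat -> cart_cat -> cart_cat;
  tunit : cart_cat;
  p0 : forall A B, hom (tens A B) A;
  p1 : forall A B, hom (tens A B) B;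
  pairing : forall {X A B}, hom X A -> hom X B -> hom X (tens A B);
  pairing_p0 : forall X A B (f : hom X A) (g : hom X B), pairing f g ;; p0 A B = f;
  pairing_p1 : forall X A B (f : hom X A) (g : hom X B), pairing f g ;; p1 A B = g;
  pairing_unique : forall X A B (f : hom X A) (g : hom X B) (h : hom X (tens A B)),
    h ;; p0 A B = f -> h ;; p1 A B = g -> h = pairing f g;
  terminal : forall X, hom X tunit;
  terminal_unique : forall X (f : hom X tunit), f = terminal X;
  tensA : forall A B D, tens (tens A B) D = tens A (tens B D);
  tens1l : forall A, tens tunit A = A;
  tens1r : forall A, tens A tunit = A;
  assoc_strict : forall A B D,
    pairing (p0 (tens A B) D ;; p0 A B)
      (pairing (p0 (tens A B) D ;; p1 A B) (p1 (tens A B) D))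
    ≡ idm (tens (tens A B) D);
  unitl_strict : forall A, p1 tunit A ≡ idm A;
  unitr_strict : forall A, p0 A tunit ≡ idm A
}.
Arguments tens {c} A B.
Arguments tunit {c}.
Arguments p0 {c} A B.
Arguments p1 {c} A B.
Arguments pairing {c X A B} f g.
Arguments pairing_unique {c X A B f g h}.
Arguments tensA {c} A B D.
Arguments tens1l {c} A.
Arguments tens1r {c} A.
Arguments assoc_strict {c} A B D.
Arguments unitl_strict {c} A.
Arguments unitr_strict {c} A.

Notation "A ⊗ B" := (tens A B) (at level 38, right associativity).
Notation "⟨ f , g ⟩" := (pairing f g).

Definition tensm {C : CartCategory} {A A' B B' : C} (f : hom A A') (g : hom B B') :
  hom (A ⊗ B) (A' ⊗ B') := ⟨p0 A B ;; f, p1 A B ;; g⟩.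
Notation "f ⊗₁ g" := (tensm f g) (at level 38, right associativity).

Definition symm {C : CartCategory} (A B : C) : hom (A ⊗ B) (B ⊗ A) := ⟨p1 A B, p0 A B⟩.

Record CCCategory := {
  ccc_cart :> CartCategory;
  (* [expo X A] is X^A. *)
  expo : ccc_cart -> ccc_cart -> ccc_cart;
  ev : forall X A, hom (expo X A ⊗ A) X;
  lam : forall {B A X}, hom (B ⊗ A) X -> hom B (expo X A);
  lam_ev : forall B A X (f : hom (B ⊗ A) X), (lam f ⊗₁ idm A) ;; ev X A = f;
  lam_unique : forall B A X (f : hom (B ⊗ A) X) (g : hom B (expo X A)),
    (g ⊗₁ idm A) ;; ev X A = f -> g = lam f
}.
Arguments expo {c} X A.
Arguments ev {c} X A.
Arguments lam {c B A X} f.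
Arguments lam_unique {c B A X f g}.

Record DistCCCategory := {
  dist_ccc :> CCCategory;
  osum : dist_ccc -> dist_ccc -> dist_ccc;
  s0 : forall A B, hom A (osum A B);
  s1 : forall A B, hom B (osum A B);
  copairing : forall {A B X}, hom A X -> hom B X -> hom (osum A B) X;
  copairing_s0 : forall A B X (f : hom A X) (g : hom B X), s0 A B ;; copairing f g = f;
  copairing_s1 : forall A B X (f : hom A X) (g : hom B X), s1 A B ;; copairing f g = g;
  copairing_unique : forall A B X (f : hom A X) (g : hom B X) (h : hom (osum A B) X),
    s0 A B ;; h = f -> s1 A B ;; h = g -> h = copairing f g;
  distr : forall A B X, hom (osum A B ⊗ X) (osum (A ⊗ X) (B ⊗ X));
  distr_K : forall A B X,
    distr A B X ;; copairing (s0 A B ⊗₁ idm X) (s1 A B ⊗₁ idm X) = idm _;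
  distrK : forall A B X,
    copairing (s0 A B ⊗₁ idm X) (s1 A B ⊗₁ idm X) ;; distr A B X = idm _;
  distl : forall A B X, hom (X ⊗ osum A B) (osum (X ⊗ A) (X ⊗ B));
  distl_K : forall A B X,
    distl A B X ;; copairing (idm X ⊗₁ s0 A B) (idm X ⊗₁ s1 A B) = idm _;
  distlK : forall A B X,
    copairing (idm X ⊗₁ s0 A B) (idm X ⊗₁ s1 A B) ;; distl A B X = idm _
}.
Arguments osum {d} A B.
Arguments s0 {d} A B.
Arguments s1 {d} A B.
Arguments copairing {d A B X} f g.
Arguments copairing_s0 {d A B X}.
Arguments copairing_s1 {d A B X}.
Arguments copairing_unique {d A B X f g h}.
Arguments distr {d} A B X.
Arguments distl {d} A B X.

Notation "A ⊕ B" := (osum A B) (at level 40, left associativity).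

Definition osumm {C : DistCCCategory} {A A' B B' : C} (f : hom A A') (g : hom B B') :
  hom (A ⊕ B) (A' ⊕ B') := copairing (f ;; s0 A' B') (g ;; s1 A' B').

Section Heq.
Context {C : Category}.
Implicit Types A B D : C.

Lemma heq_eq A B (f g : hom A B) : f ≡ g -> f = g.
Proof.
  intros H. inversion H as [H1].
  apply inj_pair2 in H1. apply inj_pair2 in H1. exact H1.
Qed.

Lemma eq_heq A B (f g : hom A B) : f = g -> f ≡ g.
Proof. intros ->; reflexivity. Qed.

Lemma hcast_heq A A' B B' (eA : A = A') (eB : B = B') (f : hom A B) : hcast eA eB f ≡ f.
Proof. destruct eA, eB; reflexivity. Qed.

Lemma comp_heq A B D A' B' D' (f : hom A B) (g : hom B D) (f' : hom A' B') (g' : hom B' D') :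
  f ≡ f' -> g ≡ g' -> f ;; g ≡ f' ;; g'.
Proof.
  intros Hf Hg.
  assert (A = A') by exact (f_equal (@src C) Hf).
  assert (B = B') by exact (f_equal (@tgt C) Hf).
  assert (D = D') by exact (f_equal (@tgt C) Hg).
  subst. apply heq_eq in Hf, Hg. subst. reflexivity.
Qed.

Lemma heq_idl A B A' D (u : hom A B) (f : hom B D) : u ≡ idm A' -> u ;; f ≡ f.
Proof.
  intros Hu.
  assert (A = A') by exact (f_equal (@src C) Hu).
  assert (B = A') by exact (f_equal (@tgt C) Hu).
  subst. apply heq_eq in Hu. subst. now rewrite comp_idl.
Qed.

Lemma heq_idr A B B' D (f : hom A B) (u : hom B D) : u ≡ idm B' -> f ;; u ≡ f.
Proof.
  intros Hu.
  assert (B = B') by exact (f_equal (@src C) Hu).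
  assert (D = B') by exact (f_equal (@tgt C) Hu).
  subst. apply heq_eq in Hu. subst. now rewrite comp_idr.
Qed.

Lemma idm_heq A B : A = B -> idm A ≡ idm B.
Proof. intros ->; reflexivity. Qed.
End Heq.

Ltac heq_destruct :=
  repeat match goal with
  | H : @mkArrow ?C ?A ?B ?f = @mkArrow _ ?A' ?B' ?g |- _ =>
      first [ apply heq_eq in H; subst
            | let e := fresh "e" in let e' := fresh "e" in
              pose proof (f_equal (@src C) H) as e; pose proof (f_equal (@tgt C) H) as e';
              cbn in e, e'; subst; apply heq_eq in H; subst ]
  end.

Section Cart.
Context {C : CartCategory}.
Implicit Types A B D X Y Z : C.

Lemma pairing_comp X' X A B (h : hom X' X) (f : hom X A) (g : hom X B) :
  h ;; ⟨f, g⟩ = ⟨h ;; f, h ;; g⟩.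
Proof. apply pairing_unique; rewrite comp_assoc; now rewrite ?pairing_p0, ?pairing_p1. Qed.

Lemma pairing_ext X A B (f g : hom X (A ⊗ B)) :
  f ;; p0 A B = g ;; p0 A B -> f ;; p1 A B = g ;; p1 A B -> f = g.
Proof. intros H0 H1. rewrite (pairing_unique H0 H1). symmetry. now apply pairing_unique. Qed.

Lemma comp_pairing_p0 X A B D (f : hom X A) (g : hom X B) (k : hom A D) :
  ⟨f, g⟩ ;; (p0 A B ;; k) = f ;; k.
Proof. now rewrite <- comp_assoc, pairing_p0. Qed.

Lemma comp_pairing_p1 X A B D (f : hom X A) (g : hom X B) (k : hom B D) :
  ⟨f, g⟩ ;; (p1 A B ;; k) = g ;; k.
Proof. now rewrite <- comp_assoc, pairing_p1. Qed.

Lemma tensm_heq A A' B B' D D' E E' (f : hom A A') (g : hom B B') (f' : hom D D') (g' : hom E E') :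
  f ≡ f' -> g ≡ g' -> f ⊗₁ g ≡ f' ⊗₁ g'.
Proof.
  intros Hf Hg.
  assert (A = D) by exact (f_equal (@src C) Hf).
  assert (A' = D') by exact (f_equal (@tgt C) Hf).
  assert (B = E) by exact (f_equal (@src C) Hg).
  assert (B' = E') by exact (f_equal (@tgt C) Hg).
  subst. apply heq_eq in Hf, Hg. subst. reflexivity.
Qed.

Lemma pairing_comp_comp X' X A B D (h : hom X' X) (f : hom X A) (g : hom X B)
  (k : hom (A ⊗ B) D) : h ;; (⟨f, g⟩ ;; k) = ⟨h ;; f, h ;; g⟩ ;; k.
Proof. now rewrite <- comp_assoc, pairing_comp. Qed.
End Cart.

Ltac cart :=
  unfold tensm, symm in *;
  repeat first
    [ rewrite comp_assoc | rewrite comp_idl | rewrite comp_idr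
    | rewrite pairing_p0 | rewrite pairing_p1
    | rewrite comp_pairing_p0 | rewrite comp_pairing_p1 | rewrite pairing_comp
    | rewrite pairing_comp_comp ];
  try reflexivity.

Section Cart2.
Context {C : CartCategory}.
Implicit Types A B D X Y Z : C.

Lemma pairing_p0p1 A B : ⟨p0 A B, p1 A B⟩ = idm (A ⊗ B).
Proof. apply pairing_ext; cart. Qed.

Lemma tensm_id A B : idm A ⊗₁ idm B = idm (A ⊗ B).
Proof. apply pairing_ext; cart. Qed.

Lemma tensm_comp A A' A'' B B' B'' (f : hom A A') (f' : hom A' A'') (g : hom B B') (g' : hom B' B'') :
  (f ⊗₁ g) ;; (f' ⊗₁ g') = (f ;; f') ⊗₁ (g ;; g').
Proof. apply pairing_ext; cart. Qed.

Lemma tensm_compl A A' A'' B (f : hom A A') (f' : hom A' A'') :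
  (f ;; f') ⊗₁ idm B = (f ⊗₁ idm B) ;; (f' ⊗₁ idm B).
Proof. now rewrite tensm_comp, comp_idl. Qed.

Definition assoc A B D : hom ((A ⊗ B) ⊗ D) (A ⊗ (B ⊗ D)) :=
  ⟨p0 (A ⊗ B) D ;; p0 A B, ⟨p0 (A ⊗ B) D ;; p1 A B, p1 (A ⊗ B) D⟩⟩.

Lemma assoc_heq A B D : assoc A B D ≡ idm ((A ⊗ B) ⊗ D).
Proof. apply assoc_strict. Qed.

Lemma tensm_assoc A B D A' B' D' (f : hom A A') (g : hom B B') (h : hom D D') :
  (f ⊗₁ g) ⊗₁ h ≡ f ⊗₁ (g ⊗₁ h).
Proof.
  assert (H : ((f ⊗₁ g) ⊗₁ h) ;; assoc A' B' D' = assoc A B D ;; (f ⊗₁ (g ⊗₁ h))).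
  { unfold assoc. apply pairing_ext; [|apply pairing_ext]; cart. }
  apply eq_heq in H.
  rewrite (heq_idr _ _ (assoc_heq _ _ _)) in H.
  now rewrite (heq_idl _ _ (assoc_heq _ _ _)) in H.
Qed.

Lemma tensm_unitr A A' (f : hom A A') : f ⊗₁ idm tunit ≡ f.
Proof.
  assert (H : (f ⊗₁ idm tunit) ;; p0 _ _ = p0 _ _ ;; f) by cart.
  apply eq_heq in H.
  rewrite (heq_idr _ _ (unitr_strict _)) in H.
  now rewrite (heq_idl _ _ (unitr_strict _)) in H.
Qed.

Lemma tensm_unitl A A' (f : hom A A') : idm tunit ⊗₁ f ≡ f.
Proof.
  assert (H : (idm tunit ⊗₁ f) ;; p1 _ _ = p1 _ _ ;; f) by cart.
  apply eq_heq in H.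
  rewrite (heq_idr _ _ (unitl_strict _)) in H.
  now rewrite (heq_idl _ _ (unitl_strict _)) in H.
Qed.

Lemma tensm_p0 A A' B B' (f : hom A A') (g : hom B B') : (f ⊗₁ g) ;; p0 A' B' = p0 A B ;; f.
Proof. cart. Qed.

Lemma tensm_p1 A A' B B' (f : hom A A') (g : hom B B') : (f ⊗₁ g) ;; p1 A' B' = p1 A B ;; g.
Proof. cart. Qed.

Lemma pairing_tensm X A A' B B' (a : hom X A) (b : hom X B) (f : hom A A') (g : hom B B') :
  ⟨a, b⟩ ;; (f ⊗₁ g) = ⟨a ;; f, b ;; g⟩.
Proof. apply pairing_ext; cart. Qed.

Lemma pairing_heq X A B X' A' B' (f : hom X A) (g : hom X B) (f' : hom X' A') (g' : hom X' B') :
  f ≡ f' -> g ≡ g' -> ⟨f, g⟩ ≡ ⟨f', g'⟩.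
Proof.
  intros Hf Hg.
  assert (X = X') by exact (f_equal (@src C) Hf).
  assert (A = A') by exact (f_equal (@tgt C) Hf).
  assert (B = B') by exact (f_equal (@tgt C) Hg).
  subst. apply heq_eq in Hf, Hg. subst. reflexivity.
Qed.

(* [1_X ⊗ σ_{A,Y}] up to the strict associativity of the endpoints, see
   [swap_heq]. *)
Definition swap X A Y : hom ((X ⊗ A) ⊗ Y) ((X ⊗ Y) ⊗ A) :=
  ⟨⟨p0 (X ⊗ A) Y ;; p0 X A, p1 (X ⊗ A) Y⟩, p0 (X ⊗ A) Y ;; p1 X A⟩.

Lemma swap_heq X A Y : idm X ⊗₁ symm A Y ≡ swap X A Y.
Proof.
  assert (H : assoc X A Y ;; (idm X ⊗₁ symm A Y) = swap X A Y ;; assoc X Y A).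
  { unfold assoc, swap. apply pairing_ext; [|apply pairing_ext]; cart. }
  apply eq_heq in H.
  rewrite (heq_idr _ _ (assoc_heq _ _ _)) in H.
  now rewrite (heq_idl _ _ (assoc_heq _ _ _)) in H.
Qed.

Lemma swap_unit X A : swap X A tunit ≡ idm (X ⊗ A).
Proof.
  assert (H : swap X A tunit ;; (p0 X tunit ⊗₁ idm A) = p0 (X ⊗ A) tunit).
  { unfold swap. apply pairing_ext; cart. }
  apply eq_heq in H.
  assert (K : p0 X tunit ⊗₁ idm A ≡ idm (X ⊗ A)).
  { rewrite <- tensm_id. apply tensm_heq; [apply unitr_strict|reflexivity]. }
  rewrite (heq_idr _ _ K) in H. rewrite H. apply unitr_strict.
Qed.

Lemma swap_assoc X A Y Z :
  (swap X A Y ⊗₁ idm Z) ;; swap (X ⊗ Y) A Z ≡ swap X A (Y ⊗ Z).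
Proof.
  assert (H : ((swap X A Y ⊗₁ idm Z) ;; swap (X ⊗ Y) A Z) ;; (assoc X Y Z ⊗₁ idm A)
              = assoc (X ⊗ A) Y Z ;; swap X A (Y ⊗ Z)).
  { unfold assoc, swap. repeat apply pairing_ext; cart. }
  apply eq_heq in H.
  assert (K : assoc X Y Z ⊗₁ idm A ≡ idm (((X ⊗ Y) ⊗ Z) ⊗ A)).
  { rewrite <- tensm_id. apply tensm_heq; [apply assoc_heq|reflexivity]. }
  rewrite (heq_idr _ _ K), (heq_idl _ _ (assoc_heq _ _ _)) in H. exact H.
Qed.

Lemma swap_nat X X' A A' Y Y' (f : hom X X') (a : hom A A') (g : hom Y Y') :
  ((f ⊗₁ a) ⊗₁ g) ;; swap X' A' Y' = swap X A Y ;; ((f ⊗₁ g) ⊗₁ a).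
Proof. unfold swap. repeat apply pairing_ext; cart. Qed.
End Cart2.

Record StrongFunctor (C : CartCategory) := {
  fob :> C -> C;
  fmap : forall {X Y}, hom X Y -> hom (fob X) (fob Y);
  fmap_id : forall X, fmap (idm X) = idm (fob X);
  fmap_comp : forall X Y Z (f : hom X Y) (g : hom Y Z), fmap (f ;; g) = fmap f ;; fmap g;
  str : forall X Y, hom (fob X ⊗ Y) (fob (X ⊗ Y));
  str_nat : forall X X' Y Y' (f : hom X X') (g : hom Y Y'),
    (fmap f ⊗₁ g) ;; str X' Y' = str X Y ;; fmap (f ⊗₁ g);
  str_unit : forall X, str X tunit ≡ idm (fob X);
  str_assoc : forall X Y Z, (str X Y ⊗₁ idm Z) ;; str (X ⊗ Y) Z ≡ str X (Y ⊗ Z)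
}.
Arguments fmap {C} s {X Y} f.
Arguments str {C} s X Y.

Record StrongNat {C : CartCategory} (F G : StrongFunctor C) := {
  ncomp :> forall X, hom (F X) (G X);
  ncomp_nat : forall X Y (f : hom X Y), fmap F f ;; ncomp Y = ncomp X ;; fmap G f;
  ncomp_str : forall X Y, (ncomp X ⊗₁ idm Y) ;; str G X Y = str F X Y ;; ncomp (X ⊗ Y)
}.

Section StrongLemmas.
Context {C : CartCategory}.
Implicit Types F G H : StrongFunctor C.

Lemma StrongFunctor_eq F G (eo : fob F = fob G) :
  (forall X Y (f : hom X Y), fmap F f ≡ fmap G f) ->
  (forall X Y, str F X Y ≡ str G X Y) -> F = G.
Proof.
  destruct F as [o m mi mc s sn su sa], G as [o' m' mi' mc' s' sn' su' sa'].
  simpl in *. subst o'. intros Hm Hs.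
  assert (m = m').
  { extensionality X. extensionality Y. extensionality f. apply heq_eq, Hm. }
  assert (s = s').
  { extensionality X. extensionality Y. apply heq_eq, Hs. }
  subst. f_equal; apply proof_irrelevance.
Qed.

Lemma StrongNat_eq F G (a b : StrongNat F G) : (forall X, a X = b X) -> a = b.
Proof.
  destruct a as [a an as_], b as [b bn bs]. simpl. intros H.
  assert (a = b) by (extensionality X; apply H).
  subst. f_equal; apply proof_irrelevance.
Qed.

Lemma fmap_heq F X Y X' Y' (f : hom X Y) (g : hom X' Y') : f ≡ g -> fmap F f ≡ fmap F g.
Proof. intros. heq_destruct. reflexivity. Qed.

Lemma fmap_idm_heq F X Y Z (f : hom X Y) : f ≡ idm Z -> fmap F f ≡ idm (F X).
Proof. intros. heq_destruct. now rewrite fmap_id. Qed.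

Lemma str_heq F X Y X' Y' : X = X' -> Y = Y' -> str F X Y ≡ str F X' Y'.
Proof. intros -> ->. reflexivity. Qed.

Lemma ncomp_heq F G (a : StrongNat F G) X X' : X = X' -> a X ≡ a X'.
Proof. intros ->. reflexivity. Qed.
End StrongLemmas.

Program Definition idSF (C : CartCategory) : StrongFunctor C :=
  {| fob := fun X => X; fmap := fun X Y f => f; str := fun X Y => idm (X ⊗ Y) |}.
Next Obligation. reflexivity. Qed.
Next Obligation. reflexivity. Qed.
Next Obligation.
  intros; cbv beta.
  now rewrite comp_idr, comp_idl.
Qed.
Next Obligation.
  intros; cbv beta.
  apply idm_heq, tens1r.
Qed.
Next Obligation.
  intros; cbv beta.
  rewrite tensm_id, comp_idl. apply idm_heq, tensA.
Qed.

Program Definition compSF {C : CartCategory} (F G : StrongFunctor C) : StrongFunctor C :=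
  {| fob := fun X => F (G X);
            fmap := fun X Y f => fmap F (fmap G f);
            str := fun X Y => str F (G X) Y ;; fmap F (str G X Y) |}.
Next Obligation.
  intros; cbv beta.
  now rewrite !fmap_id.
Qed.
Next Obligation.
  intros; cbv beta.
  now rewrite !fmap_comp.
Qed.
Next Obligation.
  intros; cbv beta.
  now rewrite <- comp_assoc, str_nat, !comp_assoc, <- !fmap_comp, str_nat.
Qed.
Next Obligation.
  intros; cbv beta.
  rewrite (heq_idr _ _ (fmap_idm_heq F (str_unit G X))). apply str_unit.
Qed.
Next Obligation.
  intros; cbv beta.
  rewrite tensm_compl, !comp_assoc, <- (comp_assoc (fmap F _ ⊗₁ _)).
  rewrite str_nat, comp_assoc, <- fmap_comp, <- comp_assoc.
  apply comp_heq; [apply str_assoc | apply fmap_heq, str_assoc].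
Qed.

Definition circ_str {C : CartCategory} (A X Y : C) : hom ((X ⊗ A) ⊗ Y) ((X ⊗ Y) ⊗ A) :=
  hcast (eq_sym (tensA X A Y)) (eq_sym (tensA X Y A)) (idm X ⊗₁ symm A Y).

Lemma circ_strE {C : CartCategory} (A X Y : C) : circ_str A X Y = swap X A Y.
Proof. apply heq_eq. unfold circ_str. rewrite hcast_heq. apply swap_heq. Qed.

Program Definition circSF {C : CartCategory} (A : C) : StrongFunctor C :=
  {| fob := fun X => X ⊗ A;
            fmap := fun X Y f => f ⊗₁ idm A;
            str := fun X Y => circ_str A X Y |}.
Next Obligation.
  intros; cbv beta; rewrite ?circ_strE.
  apply tensm_id.
Qed.
Next Obligation.
  intros; cbv beta; rewrite ?circ_strE.
  apply tensm_compl.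
Qed.
Next Obligation.
  intros; cbv beta; rewrite ?circ_strE.
  apply swap_nat.
Qed.
Next Obligation.
  intros; cbv beta; rewrite ?circ_strE.
  apply swap_unit.
Qed.
Next Obligation.
  intros; cbv beta; rewrite ?circ_strE.
  apply swap_assoc.
Qed.

Section Exp.
Context {C : CCCategory}.
Implicit Types A B X Y Z : C.

Lemma lam_ext B A X (g h : hom B (expo X A)) :
  (g ⊗₁ idm A) ;; ev X A = (h ⊗₁ idm A) ;; ev X A -> g = h.
Proof. intros H. rewrite (lam_unique H). symmetry. now apply lam_unique. Qed.

Definition bullet_fmap A {X Y} (f : hom X Y) : hom (expo X A) (expo Y A) := lam (ev X A ;; f).

Definition bullet_str A X Y : hom (expo X A ⊗ Y) (expo (X ⊗ Y) A) :=
  lam (hcast (eq_sym (tensA (expo X A) Y A)) (eq_sym (tensA (expo X A) A Y))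
         (idm (expo X A) ⊗₁ symm Y A)
       ;; (ev X A ⊗₁ idm Y)).

Lemma bullet_str_ev A X Y :
  (bullet_str A X Y ⊗₁ idm A) ;; ev (X ⊗ Y) A = swap (expo X A) Y A ;; (ev X A ⊗₁ idm Y).
Proof.
  unfold bullet_str. rewrite lam_ev. f_equal.
  apply heq_eq. rewrite hcast_heq. apply swap_heq.
Qed.

Lemma bullet_fmap_ev A X Y (f : hom X Y) :
  (bullet_fmap A f ⊗₁ idm A) ;; ev Y A = ev X A ;; f.
Proof. apply lam_ev. Qed.

Program Definition bulletSF (A : C) : StrongFunctor C :=
  {| fob := fun X => expo X A;
            fmap := fun X Y f => bullet_fmap A f;
            str := fun X Y => bullet_str A X Y |}.
Next Obligation.
  intros; cbv beta.
  apply lam_ext. rewrite bullet_fmap_ev, comp_idr, tensm_id. now rewrite comp_idl.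
Qed.
Next Obligation.
  intros; cbv beta.
  apply lam_ext. rewrite tensm_compl, comp_assoc, !bullet_fmap_ev.
  now rewrite <- (comp_assoc (_ ⊗₁ _)), bullet_fmap_ev, comp_assoc.
Qed.
Next Obligation.
  intros; cbv beta.
  apply lam_ext.
  rewrite !tensm_compl, !comp_assoc, bullet_str_ev, bullet_fmap_ev.
  rewrite <- !comp_assoc, bullet_str_ev, swap_nat, !comp_assoc. f_equal.
  rewrite !tensm_comp, bullet_fmap_ev. now rewrite comp_idr, comp_idl.
Qed.
Next Obligation.
  intros; cbv beta.
  assert (H : bullet_str A X tunit ;; bullet_fmap A (p0 X tunit) = p0 (expo X A) tunit).
  { apply lam_ext.
    rewrite tensm_compl, comp_assoc, bullet_fmap_ev, <- comp_assoc, bullet_str_ev.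
    unfold swap. cart. }
  apply eq_heq in H.
  assert (K : bullet_fmap A (p0 X tunit) ≡ idm (expo X A)).
  { assert (K : forall Z (u : hom Z X), u ≡ idm X -> bullet_fmap A u ≡ idm (expo X A)).
    { intros Z u Hu. heq_destruct. apply eq_heq, lam_ext.
      rewrite bullet_fmap_ev, tensm_id. now rewrite comp_idl, comp_idr. }
    apply K, unitr_strict. }
  rewrite (heq_idr _ _ K) in H. rewrite H. apply unitr_strict.
Qed.
Next Obligation.
  intros; cbv beta.
  assert (H : ((bullet_str A X Y ⊗₁ idm Z) ;; bullet_str A (X ⊗ Y) Z)
                ;; bullet_fmap A (assoc X Y Z)
              = assoc (expo X A) Y Z ;; bullet_str A X (Y ⊗ Z)).
  { apply lam_ext.
    rewrite !tensm_compl, !comp_assoc, bullet_fmap_ev, bullet_str_ev.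
    rewrite <- (comp_assoc (bullet_str A (X ⊗ Y) Z ⊗₁ _)), bullet_str_ev.
    rewrite !comp_assoc, <- (comp_assoc ((_ ⊗₁ _) ⊗₁ _)), swap_nat, !comp_assoc.
    rewrite <- (comp_assoc ((bullet_str A X Y ⊗₁ _) ⊗₁ _)), <- tensm_compl, bullet_str_ev.
    unfold swap, assoc. cart. }
  apply eq_heq in H.
  assert (K : bullet_fmap A (assoc X Y Z) ≡ idm (expo ((X ⊗ Y) ⊗ Z) A)).
  { assert (K : forall V W (u : hom V W), u ≡ idm V -> bullet_fmap A u ≡ idm (expo V A)).
    { intros V W u Hu. heq_destruct. apply eq_heq, lam_ext.
      rewrite bullet_fmap_ev, tensm_id. now rewrite comp_idl, comp_idr. }
    apply K, assoc_heq. }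
  rewrite (heq_idr _ _ K), (heq_idl _ _ (assoc_heq _ _ _)) in H. exact H.
Qed.
End Exp.

Record Monoid := {
  mcarrier :> Type;
  mop : mcarrier -> mcarrier -> mcarrier;
  munit : mcarrier;
  mopA : forall x y z, mop (mop x y) z = mop x (mop y z);
  mop1l : forall x, mop munit x = x;
  mop1r : forall x, mop x munit = x
}.
Arguments mop {m} x y.
Arguments munit {m}.

(* A cell together with its boundary; [α ≋ β] is equality of cells whose
   boundaries are only propositionally equal (compare [≡]). *)
Record Square {V H : Type} (cell : V -> H -> H -> V -> Type) := mkSquare {
  sq_left : V; sq_top : H; sq_bot : H; sq_right : V;
  sq_cell : cell sq_left sq_top sq_bot sq_right
}.
Arguments mkSquare {V H cell sq_left sq_top sq_bot sq_right} sq_cell.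
Notation "α ≋ β" := (mkSquare α = mkSquare β) (at level 70, no associativity).

(* The arguments of [cell] are the left, top, bottom and right boundaries. *)
Record DoubleCategory := {
  HE : Monoid;
  VE : Monoid;
  cell : VE -> HE -> HE -> VE -> Type;
  hcomp : forall {U A B V A' B' W},
    cell U A B V -> cell V A' B' W -> cell U (mop A A') (mop B B') W;
  vcomp : forall {U A D W U' B W'},
    cell U A D W -> cell U' D B W' -> cell (mop U U') A B (mop W W');
  hid : forall U, cell U munit munit U;
  vid : forall A, cell munit A A munit;
  hcompA : forall U A B V A' B' W A'' B'' Z
    (α : cell U A B V) (β : cell V A' B' W) (γ : cell W A'' B'' Z),
    hcomp (hcomp α β) γ ≋ hcomp α (hcomp β γ);
  hcomp1l : forall U A B W (α : cell U A B W), hcomp (hid U) α ≋ α;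
  hcomp1r : forall U A B W (α : cell U A B W), hcomp α (hid W) ≋ α;
  vcompA : forall U A B W U' D W' U'' E W''
    (α : cell U A B W) (β : cell U' B D W') (γ : cell U'' D E W''),
    vcomp (vcomp α β) γ ≋ vcomp α (vcomp β γ);
  vcomp1l : forall U A B W (α : cell U A B W), vcomp (vid A) α ≋ α;
  vcomp1r : forall U A B W (α : cell U A B W), vcomp α (vid B) ≋ α;
  hid_unit : hid munit = vid munit;
  vid_mop : forall A B, vid (mop A B) = hcomp (vid A) (vid B);
  hid_mop : forall U W, hid (mop U W) = vcomp (hid U) (hid W);
  interchange : forall U A B V A' B' W U' D V' D' W'
    (α : cell U A B V) (β : cell V A' B' W)
    (γ : cell U' B D V') (δ : cell V' B' D' W'),
    vcomp (hcomp α β) (hcomp γ δ) = hcomp (vcomp α γ) (vcomp β δ)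
}.
Arguments cell {d} U A B W.
Arguments hcomp {d U A B V A' B' W} α β.
Arguments vcomp {d U A D W U' B W'} α β.
Arguments hid {d} U.
Arguments vid {d} A.

Record DoubleFunctor (D E : DoubleCategory) := {
  hmap : HE D -> HE E;
  vmap : VE D -> VE E;
  cmap : forall {U A B W}, cell U A B W -> cell (vmap U) (hmap A) (hmap B) (vmap W);
  hmap_mop : forall A B, hmap (mop A B) = mop (hmap A) (hmap B);
  hmap_munit : hmap munit = munit;
  vmap_mop : forall U W, vmap (mop U W) = mop (vmap U) (vmap W);
  vmap_munit : vmap munit = munit;
  cmap_hcomp : forall U A B V A' B' W (α : cell U A B V) (β : cell V A' B' W),
    cmap (hcomp α β) ≋ hcomp (cmap α) (cmap β);
  cmap_vcomp : forall U A D W U' B W' (α : cell U A D W) (β : cell U' D B W'),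
    cmap (vcomp α β) ≋ vcomp (cmap α) (cmap β);
  cmap_hid : forall U, cmap (hid U) ≋ hid (vmap U);
  cmap_vid : forall A, cmap (vid A) ≋ vid (hmap A)
}.
Arguments hmap {D E} d A.
Arguments vmap {D E} d U.
Arguments cmap {D E} d {U A B W} α.

Definition tens_monoid (C : CartCategory) : Monoid :=
  {| mcarrier := C; mop := tens; munit := tunit;
     mopA := tensA; mop1l := tens1l; mop1r := tens1r |}.

Program Definition SF_monoid (C : CartCategory) : Monoid :=
  {| mcarrier := StrongFunctor C; mop := compSF; munit := idSF C |}.
Next Obligation.
  intros; apply StrongFunctor_eq; try reflexivity; intros; apply eq_heq; simpl.
  now rewrite comp_assoc, fmap_comp.
Qed.
Next Obligation.
  intros; apply StrongFunctor_eq; try reflexivity; intros; apply eq_heq; simpl.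
  now rewrite comp_idl.
Qed.
Next Obligation.
  intros; apply StrongFunctor_eq; try reflexivity; intros; apply eq_heq; simpl.
  now rewrite fmap_id, comp_idr.
Qed.

Section Stateful.
Context {C : CartCategory}.
Implicit Types U V W : StrongFunctor C.

(* The components of these cells have type UX ⊗ A -> W(X ⊗ B), up to
   conversion. *)
Definition scell U (A B : C) W : Type :=
  StrongNat (compSF (circSF A) U) (compSF W (circSF B)).

Definition scomp {U A B W} (α : scell U A B W) (X : C) : hom (U X ⊗ A) (W (X ⊗ B)) := α X.

Lemma scomp_nat U A B W (α : scell U A B W) X Y (f : hom X Y) :
  (fmap U f ⊗₁ idm A) ;; scomp α Y = scomp α X ;; fmap W (f ⊗₁ idm B).
Proof. exact (ncomp_nat α X Y f). Qed.

Lemma scomp_str U A B W (α : scell U A B W) X Y :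
  (scomp α X ⊗₁ idm Y) ;; (str W (X ⊗ B) Y ;; fmap W (swap X B Y))
  = swap (U X) A Y ;; ((str U X Y ⊗₁ idm A) ;; scomp α (X ⊗ Y)).
Proof.
  pose proof (ncomp_str α X Y) as H. simpl in H. rewrite !circ_strE, comp_assoc in H. exact H.
Qed.

Program Definition mk_scell {U A B W} (a : forall X, hom (U X ⊗ A) (W (X ⊗ B)))
  (a_nat : forall X Y (f : hom X Y),
    (fmap U f ⊗₁ idm A) ;; a Y = a X ;; fmap W (f ⊗₁ idm B))
  (a_str : forall X Y,
    (a X ⊗₁ idm Y) ;; (str W (X ⊗ B) Y ;; fmap W (swap X B Y))
    = swap (U X) A Y ;; ((str U X Y ⊗₁ idm A) ;; a (X ⊗ Y))) : scell U A B W :=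
  {| ncomp := (a : forall X, hom (compSF (circSF A) U X) (compSF W (circSF B) X)) |}.
Next Obligation.
  intros; cbv beta.
  exact (a_nat X Y f).
Qed.
Next Obligation.
  intros; cbv beta.
  simpl. rewrite !circ_strE, comp_assoc. apply a_str.
Qed.

Lemma scell_eq U A B W U' A' B' W' (α : scell U A B W) (β : scell U' A' B' W') :
  U = U' -> A = A' -> B = B' -> W = W' -> (forall X, scomp α X ≡ scomp β X) -> α ≋ β.
Proof.
  intros. subst. f_equal. apply StrongNat_eq. intros X. apply heq_eq, H3.
Qed.

Lemma scomp_heq U A B W (α : scell U A B W) X X' : X = X' -> scomp α X ≡ scomp α X'.
Proof. intros ->. reflexivity. Qed.

Lemma tensm_idm2 (X Y A B : C) (f : hom X Y) : f ⊗₁ idm (A ⊗ B) ≡ (f ⊗₁ idm A) ⊗₁ idm B.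
Proof. rewrite <- tensm_id. symmetry. apply tensm_assoc. Qed.

Lemma swap_tens (X A A' Y : C) :
  swap X (A ⊗ A') Y ≡ swap (X ⊗ A) A' Y ;; (swap X A Y ⊗₁ idm A').
Proof.
  assert (H : (assoc X A A' ⊗₁ idm Y) ;; swap X (A ⊗ A') Y
    = (swap (X ⊗ A) A' Y ;; (swap X A Y ⊗₁ idm A')) ;; assoc (X ⊗ Y) A A').
  { unfold swap, assoc. repeat apply pairing_ext; cart. }
  assert (K : assoc X A A' ⊗₁ idm Y ≡ idm (((X ⊗ A) ⊗ A') ⊗ Y)).
  { rewrite <- tensm_id. apply tensm_heq; [apply assoc_heq|reflexivity]. }
  apply eq_heq in H. now rewrite (heq_idl _ _ K), (heq_idr _ _ (assoc_heq _ _ _)) in H.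
Qed.

Lemma swap_mid (X Y : C) : swap X tunit Y ≡ idm (X ⊗ Y).
Proof.
  assert (H : swap X tunit Y ;; p0 (X ⊗ Y) tunit = p0 X tunit ⊗₁ idm Y).
  { unfold swap. apply pairing_ext; cart. }
  apply eq_heq in H. rewrite (heq_idr _ _ (unitr_strict _)) in H. rewrite H.
  rewrite <- tensm_id. apply tensm_heq; [apply unitr_strict|reflexivity].
Qed.

Definition hcomp_comp {U A B V A' B' W} (α : scell U A B V) (β : scell V A' B' W) X :
  hom (U X ⊗ (A ⊗ A')) (W (X ⊗ (B ⊗ B'))) :=
  hcast (tensA (U X) A A') (f_equal W (tensA X B B'))
    ((scomp α X ⊗₁ idm A') ;; scomp β (X ⊗ B)).

Lemma hcomp_comp_heq U A B V A' B' W (α : scell U A B V) (β : scell V A' B' W) X :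
  hcomp_comp α β X ≡ (scomp α X ⊗₁ idm A') ;; scomp β (X ⊗ B).
Proof. apply hcast_heq. Qed.

Program Definition s_hcomp {U A B V A' B' W} (α : scell U A B V) (β : scell V A' B' W) :
  scell U (A ⊗ A') (B ⊗ B') W :=
  mk_scell (hcomp_comp α β) _ _.
Next Obligation.
  intros; cbv beta.
  apply heq_eq.
  transitivity (mkArrow (((fmap U f ⊗₁ idm A) ⊗₁ idm A')
                  ;; ((scomp α Y ⊗₁ idm A') ;; scomp β (Y ⊗ B)))).
  { apply comp_heq; [apply tensm_idm2 | apply hcomp_comp_heq]. }
  transitivity (mkArrow (((scomp α X ⊗₁ idm A') ;; scomp β (X ⊗ B))
                  ;; fmap W ((f ⊗₁ idm B) ⊗₁ idm B'))).
  2: { symmetry. apply comp_heq; [apply hcomp_comp_heq | apply fmap_heq, tensm_idm2]. }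
  apply eq_heq. rewrite comp_assoc, <- scomp_nat, <- !comp_assoc.
  now rewrite <- !tensm_compl, scomp_nat.
Qed.
Next Obligation.
  intros; cbv beta.
  apply heq_eq.
  transitivity (mkArrow ((((scomp α X ⊗₁ idm A') ;; scomp β (X ⊗ B)) ⊗₁ idm Y)
     ;; (str W ((X ⊗ B) ⊗ B') Y ;;
         fmap W (swap (X ⊗ B) B' Y ;; (swap X B Y ⊗₁ idm B'))))).
  { apply comp_heq; [apply tensm_heq; [apply hcomp_comp_heq|reflexivity]|].
    apply comp_heq; [apply str_heq; auto; symmetry; apply tensA|].
    apply fmap_heq, swap_tens. }
  transitivity (mkArrow ((swap (U X ⊗ A) A' Y ;; (swap (U X) A Y ⊗₁ idm A'))
     ;; (((str U X Y ⊗₁ idm A) ⊗₁ idm A')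
         ;; ((scomp α (X ⊗ Y) ⊗₁ idm A') ;; scomp β ((X ⊗ Y) ⊗ B))))).
  2: { symmetry. apply comp_heq; [apply swap_tens|].
       apply comp_heq; [apply tensm_idm2|apply hcomp_comp_heq]. }
  apply eq_heq.
  rewrite tensm_compl, fmap_comp, !comp_assoc.
  rewrite <- (comp_assoc (str W _ _)), <- (comp_assoc (scomp β (X ⊗ B) ⊗₁ _)).
  rewrite scomp_str, !comp_assoc, <- scomp_nat.
  rewrite <- (comp_assoc ((scomp α X ⊗₁ _) ⊗₁ _)), swap_nat, !comp_assoc. f_equal.
  rewrite <- !comp_assoc. f_equal. rewrite <- !tensm_compl. f_equal.
  rewrite !comp_assoc. apply scomp_str.
Qed.

Program Definition s_vcomp {U A D W U' B W'} (α : scell U A D W) (β : scell U' D B W') :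
  scell (compSF U U') A B (compSF W W') :=
  @mk_scell (compSF U U') A B (compSF W W')
            (fun X => scomp α (U' X) ;; fmap W (scomp β X)) _ _.
Next Obligation.
  intros; cbv beta.
  simpl.
  now rewrite <- comp_assoc, scomp_nat, !comp_assoc, <- !fmap_comp, scomp_nat.
Qed.
Next Obligation.
  intros; cbv beta.
  simpl.
  rewrite !tensm_compl, !comp_assoc, <- (comp_assoc (fmap W _ ⊗₁ _)), str_nat.
  rewrite <- (comp_assoc (fmap U _ ⊗₁ _)), scomp_nat, !comp_assoc.
  rewrite <- !fmap_comp, scomp_str, !fmap_comp.
  rewrite <- (comp_assoc (str W _ _)), <- (comp_assoc (scomp α _ ⊗₁ _)), scomp_str.
  now rewrite !comp_assoc.
Qed.

Program Definition s_hid U : scell U tunit tunit U :=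
  @mk_scell U tunit tunit U
    (fun X => hcast (eq_sym (tens1r (U X))) (f_equal U (eq_sym (tens1r X))) (idm (U X))) _ _.
Next Obligation.
  intros; cbv beta.
  apply heq_eq.
  transitivity (mkArrow (fmap U f ;; idm (U Y))).
  { apply comp_heq; [apply tensm_unitr|apply hcast_heq]. }
  transitivity (mkArrow (idm (U X) ;; fmap U f)).
  2: { symmetry. apply comp_heq; [apply hcast_heq|apply fmap_heq, tensm_unitr]. }
  now rewrite comp_idl, comp_idr.
Qed.
Next Obligation.
  intros; cbv beta.
  apply heq_eq.
  transitivity (mkArrow ((idm (U X) ⊗₁ idm Y) ;; (str U X Y ;; fmap U (idm (X ⊗ Y))))).
  { apply comp_heq; [apply tensm_heq; [apply hcast_heq|reflexivity]|].
    apply comp_heq; [apply str_heq; auto; apply tens1r|].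
    apply fmap_heq, swap_mid. }
  transitivity (mkArrow (str U X Y)).
  { now rewrite tensm_id, fmap_id, comp_idl, comp_idr. }
  symmetry.
  transitivity (mkArrow (idm (U X ⊗ Y) ;; (str U X Y ;; idm (U (X ⊗ Y))))).
  { apply comp_heq; [apply swap_mid|].
    apply comp_heq; [apply tensm_unitr|apply hcast_heq]. }
  now rewrite comp_idl, comp_idr.
Qed.

Program Definition s_vid (A : C) : scell (idSF C) A A (idSF C) :=
  @mk_scell (idSF C) A A (idSF C) (fun X => idm (X ⊗ A)) _ _.
Next Obligation.
  intros; cbv beta.
  simpl. now rewrite comp_idl, comp_idr.
Qed.
Next Obligation.
  intros; cbv beta.
  simpl. now rewrite !tensm_id, !comp_idl, !comp_idr.
Qed.

Lemma s_hid_heq U X : scomp (s_hid U) X ≡ idm (U X).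
Proof. apply hcast_heq. Qed.

Lemma s_hcomp_heq U A B V A' B' W (α : scell U A B V) (β : scell V A' B' W) X :
  scomp (s_hcomp α β) X ≡ (scomp α X ⊗₁ idm A') ;; scomp β (X ⊗ B).
Proof. apply hcast_heq. Qed.
End Stateful.

Program Definition stateful (C : CartCategory) : DoubleCategory :=
  {| HE := tens_monoid C; VE := SF_monoid C; cell := @scell C;
            hcomp := @s_hcomp C; vcomp := @s_vcomp C; hid := @s_hid C; vid := @s_vid C |}.
Next Obligation.
  intros; simpl in *.
  apply scell_eq; auto using tensA. intros X.
  transitivity (mkArrow ((((scomp α X ⊗₁ idm A') ;; scomp β (X ⊗ B)) ⊗₁ idm A'')
                           ;; scomp γ ((X ⊗ B) ⊗ B'))).
  { rewrite s_hcomp_heq.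
    apply comp_heq; [apply tensm_heq; [apply s_hcomp_heq|reflexivity]|].
    apply scomp_heq. symmetry. apply tensA. }
  rewrite s_hcomp_heq, tensm_compl, comp_assoc. symmetry.
  apply comp_heq; [apply tensm_idm2|apply s_hcomp_heq].
Qed.
Next Obligation.
  intros; simpl in *.
  apply scell_eq; auto using tens1l. intros X.
  rewrite s_hcomp_heq.
  transitivity (mkArrow ((idm (U X) ⊗₁ idm A) ;; scomp α X)).
  { apply comp_heq; [apply tensm_heq; [apply s_hid_heq|reflexivity]|].
    apply scomp_heq, tens1r. }
  now rewrite tensm_id, comp_idl.
Qed.
Next Obligation.
  intros; simpl in *.
  apply scell_eq; auto using tens1r. intros X.
  rewrite s_hcomp_heq.
  transitivity (mkArrow (scomp α X ;; idm (W (X ⊗ B)))).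
  { apply comp_heq; [apply tensm_unitr|apply s_hid_heq]. }
  now rewrite comp_idr.
Qed.
Next Obligation.
  intros; simpl in *.
  apply scell_eq; try reflexivity; try apply (mopA (SF_monoid C)). intros X.
  apply eq_heq. cbn. now rewrite fmap_comp, comp_assoc.
Qed.
Next Obligation.
  intros; simpl in *.
  apply scell_eq; try reflexivity; try apply (mop1l (SF_monoid C)). intros X.
  apply eq_heq. cbn. now rewrite comp_idl.
Qed.
Next Obligation.
  intros; simpl in *.
  apply scell_eq; try reflexivity; try apply (mop1r (SF_monoid C)). intros X.
  apply eq_heq. cbn. now rewrite fmap_id, comp_idr.
Qed.
Next Obligation.
  intros; simpl in *.
  apply StrongNat_eq. intros X. apply heq_eq. cbn. rewrite hcast_heq.
  apply idm_heq. symmetry. apply tens1r.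
Qed.
Next Obligation.
  intros; simpl in *.
  apply StrongNat_eq. intros X. apply heq_eq. symmetry.
  etransitivity; [apply (s_hcomp_heq (s_vid A) (s_vid B) X)|].
  cbn. rewrite tensm_id, comp_idl. apply idm_heq, tensA.
Qed.
Next Obligation.
  intros; simpl in *.
  apply StrongNat_eq. intros X. apply heq_eq. cbn. rewrite hcast_heq. symmetry.
  transitivity (mkArrow (idm (U (W X)) ;; fmap U (idm (W X)))).
  { apply comp_heq; [apply hcast_heq|apply fmap_heq, hcast_heq]. }
  now rewrite fmap_id, comp_idl.
Qed.
Next Obligation.
  intros; simpl in *.
  apply StrongNat_eq. intros X. apply heq_eq.
  transitivity (mkArrow (((scomp α (U' X) ⊗₁ idm A') ;; scomp β (U' X ⊗ B))
      ;; fmap W ((scomp γ X ⊗₁ idm B') ;; scomp δ (X ⊗ D)))).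
  { cbn. apply comp_heq; [apply hcast_heq|apply fmap_heq, hcast_heq]. }
  etransitivity; [|symmetry; apply (s_hcomp_heq (s_vcomp α γ) (s_vcomp β δ) X)].
  apply eq_heq. cbn.
  rewrite fmap_comp, tensm_compl, !comp_assoc. f_equal.
  rewrite <- !comp_assoc. f_equal. symmetry. apply scomp_nat.
Qed.

Section Corners.
Context {C : CCCategory}.
Implicit Types A B X Y : C.

Program Definition s_mor {A B} (f : hom A B) : scell (idSF C) A B (idSF C) :=
  @mk_scell C (idSF C) A B (idSF C) (fun X => idm X ⊗₁ f) _ _.
Next Obligation.
  intros; cbv beta.
  simpl. now rewrite !tensm_comp, !comp_idl, !comp_idr.
Qed.
Next Obligation.
  intros; cbv beta.
  simpl. rewrite !tensm_id, !comp_idl, swap_nat. now rewrite tensm_id.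
Qed.

Program Definition s_putR A : scell (idSF C) A tunit (circSF A) :=
  @mk_scell C (idSF C) A tunit (circSF A)
    (fun X => hcast eq_refl (f_equal (fun Z => Z ⊗ A) (eq_sym (tens1r X))) (idm (X ⊗ A))) _ _.
Next Obligation.
  intros; cbv beta.
  apply heq_eq.
  transitivity (mkArrow ((f ⊗₁ idm A) ;; idm (Y ⊗ A))).
  { apply comp_heq; [reflexivity|apply hcast_heq]. }
  transitivity (mkArrow (idm (X ⊗ A) ;; (f ⊗₁ idm A))).
  2: { symmetry. apply comp_heq; [apply hcast_heq|].
       apply tensm_heq; [apply tensm_unitr|reflexivity]. }
  now rewrite comp_idl, comp_idr.
Qed.
Next Obligation.
  intros; cbv beta.
  apply heq_eq. cbn. rewrite circ_strE.
  transitivity (mkArrow ((idm (X ⊗ A) ⊗₁ idm Y) ;; (swap X A Y ;; (idm (X ⊗ Y) ⊗₁ idm A)))).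
  { apply comp_heq; [apply tensm_heq; [apply hcast_heq|reflexivity]|].
    apply comp_heq; [now rewrite tens1r|].
    apply tensm_heq; [apply swap_mid|reflexivity]. }
  rewrite !tensm_id, !comp_idl. apply comp_heq; [reflexivity|]. symmetry. apply hcast_heq.
Qed.

Program Definition s_getL A : scell (circSF A) tunit A (idSF C) :=
  @mk_scell C (circSF A) tunit A (idSF C)
    (fun X => hcast (eq_sym (tens1r (X ⊗ A))) eq_refl (idm (X ⊗ A))) _ _.
Next Obligation.
  intros; cbv beta.
  apply heq_eq. cbn.
  transitivity (mkArrow ((f ⊗₁ idm A) ;; idm (Y ⊗ A))).
  { apply comp_heq; [apply tensm_unitr|apply hcast_heq]. }
  rewrite comp_idr. symmetry.
  apply (heq_idl _ _ (hcast_heq _ _ (idm (X ⊗ A)))).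
Qed.
Next Obligation.
  intros; cbv beta.
  apply heq_eq. cbn. rewrite circ_strE, comp_idl.
  transitivity (mkArrow ((idm (X ⊗ A) ⊗₁ idm Y) ;; swap X A Y)).
  { apply comp_heq; [apply tensm_heq; [apply hcast_heq|reflexivity]|reflexivity]. }
  rewrite tensm_id, comp_idl. symmetry.
  rewrite (heq_idl _ _ (swap_mid _ _)).
  rewrite (heq_idr _ _ (hcast_heq _ _ (idm ((X ⊗ Y) ⊗ A)))). apply tensm_unitr.
Qed.

Program Definition s_putL A : scell (bulletSF A) A tunit (idSF C) :=
  @mk_scell C (bulletSF A) A tunit (idSF C)
    (fun X => hcast eq_refl (eq_sym (tens1r X)) (ev X A)) _ _.
Next Obligation.
  intros; cbv beta.
  apply heq_eq. cbn.
  transitivity (mkArrow ((bullet_fmap A f ⊗₁ idm A) ;; ev Y A)).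
  { apply comp_heq; [reflexivity|apply hcast_heq]. }
  rewrite bullet_fmap_ev. symmetry.
  apply comp_heq; [apply hcast_heq|apply tensm_unitr].
Qed.
Next Obligation.
  intros; cbv beta.
  apply heq_eq. cbn. rewrite comp_idl.
  transitivity (mkArrow (ev X A ⊗₁ idm Y)).
  { rewrite (heq_idr _ _ (swap_mid _ _)).
    apply tensm_heq; [apply hcast_heq|reflexivity]. }
  transitivity (mkArrow (swap (expo X A) A Y ;; ((bullet_str A X Y ⊗₁ idm A) ;; ev (X ⊗ Y) A))).
  2: { apply comp_heq; [reflexivity|]. apply comp_heq; [reflexivity|].
       symmetry; apply hcast_heq. }
  apply eq_heq. rewrite bullet_str_ev. unfold swap. apply pairing_ext; cart.
  all: f_equal. all: try (rewrite <- (comp_idl (idm _))).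
  all: try (rewrite <- pairing_comp, pairing_p0p1; cart).
Qed.

Program Definition s_getR A : scell (idSF C) tunit A (bulletSF A) :=
  @mk_scell C (idSF C) tunit A (bulletSF A)
    (fun X => hcast (eq_sym (tens1r X)) eq_refl (lam (idm (X ⊗ A)))) _ _.
Next Obligation.
  intros; cbv beta.
  apply heq_eq. cbn.
  transitivity (mkArrow (f ;; lam (idm (Y ⊗ A)))).
  { apply comp_heq; [apply tensm_unitr|apply hcast_heq]. }
  transitivity (mkArrow (lam (idm (X ⊗ A)) ;; bullet_fmap A (f ⊗₁ idm A))).
  2: { apply comp_heq; [symmetry; apply hcast_heq|reflexivity]. }
  apply eq_heq, lam_ext.
  rewrite !tensm_compl, !comp_assoc, bullet_fmap_ev, lam_ev, <- comp_assoc, lam_ev.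
  now rewrite comp_idl, comp_idr.
Qed.
Next Obligation.
  intros; cbv beta.
  apply heq_eq. cbn.
  transitivity (mkArrow ((lam (idm (X ⊗ A)) ⊗₁ idm Y)
                 ;; (bullet_str A (X ⊗ A) Y ;; bullet_fmap A (swap X A Y)))).
  { apply comp_heq; [apply tensm_heq; [apply hcast_heq|reflexivity]|reflexivity]. }
  transitivity (mkArrow (lam (idm ((X ⊗ Y) ⊗ A)))).
  2: { symmetry. rewrite (heq_idl _ _ (swap_mid _ _)).
       refine (eq_trans (heq_idl (A' := X ⊗ Y) _ _ _) _); [|apply hcast_heq].
       apply tensm_unitr. }
  apply eq_heq, lam_ext.
  rewrite !tensm_compl, !comp_assoc, bullet_fmap_ev, lam_ev.
  rewrite <- (comp_assoc (bullet_str A (X ⊗ A) Y ⊗₁ _)), bullet_str_ev, !comp_assoc.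
  rewrite <- (comp_assoc ((_ ⊗₁ _) ⊗₁ _)), swap_nat, !comp_assoc.
  rewrite <- (comp_assoc ((lam _ ⊗₁ _) ⊗₁ _)), <- tensm_compl, lam_ev, tensm_id, comp_idl.
  unfold swap. repeat apply pairing_ext; cart.
Qed.
End Corners.

Section Choice.
Context {C : DistCCCategory}.
Implicit Types A B X Y Z : C.
Implicit Types F G U V W : StrongFunctor C.

Lemma copairing_comp A B X Y (f : hom A X) (g : hom B X) (h : hom X Y) :
  copairing f g ;; h = copairing (f ;; h) (g ;; h).
Proof. apply copairing_unique; rewrite <- comp_assoc; now rewrite ?copairing_s0, ?copairing_s1. Qed.

Lemma osum_ext A B X (f g : hom (A ⊕ B) X) :
  s0 A B ;; f = s0 A B ;; g -> s1 A B ;; f = s1 A B ;; g -> f = g.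
Proof. intros H0 H1. rewrite (copairing_unique H0 H1). symmetry. now apply copairing_unique. Qed.

Lemma s0_distr A B X : (s0 A B ⊗₁ idm X) ;; distr A B X = s0 _ _.
Proof.
  rewrite <- (copairing_s0 (s0 A B ⊗₁ idm X) (s1 A B ⊗₁ idm X)), comp_assoc, distrK.
  apply comp_idr.
Qed.

Lemma s1_distr A B X : (s1 A B ⊗₁ idm X) ;; distr A B X = s1 _ _.
Proof.
  rewrite <- (copairing_s1 (s0 A B ⊗₁ idm X) (s1 A B ⊗₁ idm X)), comp_assoc, distrK.
  apply comp_idr.
Qed.

Lemma s0_distl A B X : (idm X ⊗₁ s0 A B) ;; distl A B X = s0 _ _.
Proof.
  rewrite <- (copairing_s0 (idm X ⊗₁ s0 A B) (idm X ⊗₁ s1 A B)), comp_assoc, distlK.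
  apply comp_idr.
Qed.

Lemma s1_distl A B X : (idm X ⊗₁ s1 A B) ;; distl A B X = s1 _ _.
Proof.
  rewrite <- (copairing_s1 (idm X ⊗₁ s0 A B) (idm X ⊗₁ s1 A B)), comp_assoc, distlK.
  apply comp_idr.
Qed.

Lemma distr_ext A B X Y (f g : hom ((A ⊕ B) ⊗ X) Y) :
  (s0 A B ⊗₁ idm X) ;; f = (s0 A B ⊗₁ idm X) ;; g ->
  (s1 A B ⊗₁ idm X) ;; f = (s1 A B ⊗₁ idm X) ;; g -> f = g.
Proof.
  intros H0 H1. rewrite <- (comp_idl f), <- (comp_idl g), <- distr_K, !comp_assoc. f_equal.
  rewrite !copairing_comp. now rewrite H0, H1.
Qed.

Lemma distl_ext A B X Y (f g : hom (X ⊗ (A ⊕ B)) Y) :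
  (idm X ⊗₁ s0 A B) ;; f = (idm X ⊗₁ s0 A B) ;; g ->
  (idm X ⊗₁ s1 A B) ;; f = (idm X ⊗₁ s1 A B) ;; g -> f = g.
Proof.
  intros H0 H1. rewrite <- (comp_idl f), <- (comp_idl g), <- distl_K, !comp_assoc. f_equal.
  rewrite !copairing_comp. now rewrite H0, H1.
Qed.

Lemma distr_ext2 A B X Y Z (f g : hom (((A ⊕ B) ⊗ X) ⊗ Y) Z) :
  ((s0 A B ⊗₁ idm X) ⊗₁ idm Y) ;; f = ((s0 A B ⊗₁ idm X) ⊗₁ idm Y) ;; g ->
  ((s1 A B ⊗₁ idm X) ⊗₁ idm Y) ;; f = ((s1 A B ⊗₁ idm X) ⊗₁ idm Y) ;; g -> f = g.
Proof.
  intros H0 H1. rewrite <- (comp_idl f), <- (comp_idl g), <- tensm_id, <- distr_K.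
  rewrite tensm_compl, !comp_assoc. f_equal.
  apply distr_ext; rewrite <- !comp_assoc, <- !tensm_compl;
    now rewrite ?copairing_s0, ?copairing_s1.
Qed.

Lemma distl_ext2 A B X Y Z (f g : hom ((X ⊗ (A ⊕ B)) ⊗ Y) Z) :
  ((idm X ⊗₁ s0 A B) ⊗₁ idm Y) ;; f = ((idm X ⊗₁ s0 A B) ⊗₁ idm Y) ;; g ->
  ((idm X ⊗₁ s1 A B) ⊗₁ idm Y) ;; f = ((idm X ⊗₁ s1 A B) ⊗₁ idm Y) ;; g -> f = g.
Proof.
  intros H0 H1. rewrite <- (comp_idl f), <- (comp_idl g), <- tensm_id, <- distl_K.
  rewrite tensm_compl, !comp_assoc. f_equal.
  apply distr_ext; rewrite <- !comp_assoc, <- !tensm_compl;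
    now rewrite ?copairing_s0, ?copairing_s1.
Qed.

Definition prod_str F G X Y : hom ((F X ⊗ G X) ⊗ Y) (F (X ⊗ Y) ⊗ G (X ⊗ Y)) :=
  ⟨p0 (F X) (G X) ⊗₁ idm Y, p1 (F X) (G X) ⊗₁ idm Y⟩ ;; (str F X Y ⊗₁ str G X Y).

Definition sum_str F G X Y : hom ((F X ⊕ G X) ⊗ Y) (F (X ⊗ Y) ⊕ G (X ⊗ Y)) :=
  distr (F X) (G X) Y ;; osumm (str F X Y) (str G X Y).

Lemma prod_strE F G X Y : prod_str F G X Y
  = ⟨(p0 (F X) (G X) ⊗₁ idm Y) ;; str F X Y, (p1 (F X) (G X) ⊗₁ idm Y) ;; str G X Y⟩.
Proof. unfold prod_str. apply pairing_ext; cart. Qed.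

Lemma sum_str_s0 F G X Y :
  (s0 (F X) (G X) ⊗₁ idm Y) ;; sum_str F G X Y = str F X Y ;; s0 _ _.
Proof. unfold sum_str, osumm. now rewrite <- comp_assoc, s0_distr, copairing_s0. Qed.

Lemma sum_str_s1 F G X Y :
  (s1 (F X) (G X) ⊗₁ idm Y) ;; sum_str F G X Y = str G X Y ;; s1 _ _.
Proof. unfold sum_str, osumm. now rewrite <- comp_assoc, s1_distr, copairing_s1. Qed.

Lemma osumm_s0 A A' B B' (f : hom A A') (g : hom B B') : s0 A B ;; osumm f g = f ;; s0 A' B'.
Proof. apply copairing_s0. Qed.

Lemma osumm_s1 A A' B B' (f : hom A A') (g : hom B B') : s1 A B ;; osumm f g = g ;; s1 A' B'.
Proof. apply copairing_s1. Qed.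

Lemma str_assocE F X Y Z :
  (str F X Y ⊗₁ idm Z) ;; (str F (X ⊗ Y) Z ;; fmap F (assoc X Y Z))
  = assoc (F X) Y Z ;; str F X (Y ⊗ Z).
Proof.
  apply heq_eq. rewrite <- comp_assoc.
  rewrite (heq_idr _ _ (fmap_idm_heq F (assoc_heq X Y Z))).
  rewrite (heq_idl _ _ (assoc_heq _ _ _)). apply str_assoc.
Qed.

Lemma str_unitE F X : str F X tunit ;; fmap F (p0 X tunit) = p0 (F X) tunit.
Proof.
  apply heq_eq. rewrite (heq_idr _ _ (fmap_idm_heq F (unitr_strict X))).
  rewrite str_unit. symmetry. apply unitr_strict.
Qed.

Program Definition prodSF F G : StrongFunctor C :=
  {| fob := fun X => F X ⊗ G X;
            fmap := fun X Y f => fmap F f ⊗₁ fmap G f;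
            str := fun X Y => prod_str F G X Y |}.
Next Obligation.
  intros; cbv beta; rewrite ?prod_strE.
  now rewrite !fmap_id, tensm_id.
Qed.
Next Obligation.
  intros; cbv beta; rewrite ?prod_strE.
  now rewrite !fmap_comp, tensm_comp.
Qed.
Next Obligation.
  intros; cbv beta; rewrite ?prod_strE.
  rewrite pairing_comp, pairing_tensm. f_equal.
  + rewrite !comp_assoc, <- str_nat, <- !comp_assoc, !tensm_comp.
    now rewrite tensm_p0, comp_idl, comp_idr.
  + rewrite !comp_assoc, <- str_nat, <- !comp_assoc, !tensm_comp.
    now rewrite tensm_p1, comp_idl, comp_idr.
Qed.
Next Obligation.
  intros; cbv beta; rewrite ?prod_strE.
  rewrite <- pairing_p0p1. apply pairing_heq.
  + rewrite (heq_idr _ _ (str_unit F X)). apply tensm_unitr.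
  + rewrite (heq_idr _ _ (str_unit G X)). apply tensm_unitr.
Qed.
Next Obligation.
  intros; cbv beta; rewrite ?prod_strE.
  rewrite pairing_comp, <- !comp_assoc, !tensm_comp, !pairing_p0, !pairing_p1.
  rewrite !comp_idl, !tensm_compl, !comp_assoc. apply pairing_heq.
  + apply comp_heq; [symmetry; apply tensm_idm2|apply str_assoc].
  + apply comp_heq; [symmetry; apply tensm_idm2|apply str_assoc].
Qed.

Program Definition sumSF F G : StrongFunctor C :=
  {| fob := fun X => F X ⊕ G X;
            fmap := fun X Y f => osumm (fmap F f) (fmap G f);
            str := fun X Y => sum_str F G X Y |}.
Next Obligation.
  intros; cbv beta.
  rewrite !fmap_id. apply osum_ext; now rewrite ?osumm_s0, ?osumm_s1, comp_idl, comp_idr.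
Qed.
Next Obligation.
  intros; cbv beta.
  rewrite !fmap_comp. apply osum_ext; rewrite <- comp_assoc, ?osumm_s0, ?osumm_s1.
  + now rewrite !comp_assoc, osumm_s0.
  + now rewrite !comp_assoc, osumm_s1.
Qed.
Next Obligation.
  intros; cbv beta.
  apply distr_ext.
  + rewrite <- !comp_assoc, sum_str_s0, tensm_comp, osumm_s0, comp_assoc, osumm_s0.
    rewrite <- comp_assoc, <- str_nat, !comp_assoc, <- sum_str_s0, <- !comp_assoc.
    now rewrite tensm_comp, comp_idl, comp_idr.
  + rewrite <- !comp_assoc, sum_str_s1, tensm_comp, osumm_s1, comp_assoc, osumm_s1.
    rewrite <- comp_assoc, <- str_nat, !comp_assoc, <- sum_str_s1, <- !comp_assoc.
    now rewrite tensm_comp, comp_idl, comp_idr.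
Qed.
Next Obligation.
  intros; cbv beta.
  assert (H : sum_str F G X tunit ;; osumm (fmap F (p0 X tunit)) (fmap G (p0 X tunit))
              = p0 (F X ⊕ G X) tunit).
  { apply distr_ext; rewrite <- !comp_assoc, ?sum_str_s0, ?sum_str_s1, comp_assoc,
      ?osumm_s0, ?osumm_s1, <- comp_assoc, str_unitE, tensm_p0; reflexivity. }
  apply eq_heq in H.
  assert (K : osumm (fmap F (p0 X tunit)) (fmap G (p0 X tunit)) ≡ idm (F X ⊕ G X)).
  { assert (K : forall (P : C) (u : hom P X), u ≡ idm X ->
               osumm (fmap F u) (fmap G u) ≡ idm (F X ⊕ G X)).
    { intros P u Hu. heq_destruct. rewrite !fmap_id. apply eq_heq, osum_ext;
        now rewrite ?osumm_s0, ?osumm_s1, comp_idl, comp_idr. }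
    apply K, unitr_strict. }
  rewrite (heq_idr _ _ K) in H. rewrite H. apply unitr_strict.
Qed.
Next Obligation.
  intros; cbv beta.
  assert (H : ((sum_str F G X Y ⊗₁ idm Z) ;; sum_str F G (X ⊗ Y) Z)
                ;; osumm (fmap F (assoc X Y Z)) (fmap G (assoc X Y Z))
              = assoc (F X ⊕ G X) Y Z ;; sum_str F G X (Y ⊗ Z)).
  { apply distr_ext2; rewrite <- !comp_assoc, <- tensm_compl, ?sum_str_s0, ?sum_str_s1,
      tensm_compl, !comp_assoc.
    - rewrite <- (comp_assoc (s0 _ _ ⊗₁ _)), sum_str_s0, comp_assoc, osumm_s0.
      rewrite <- (comp_assoc (str F (X ⊗ Y) Z)), <- comp_assoc, str_assocE.
      rewrite comp_assoc, <- sum_str_s0, <- !comp_assoc. f_equal.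
      apply heq_eq. rewrite (heq_idl _ _ (assoc_heq _ _ _)), (heq_idr _ _ (assoc_heq _ _ _)).
      apply tensm_idm2.
    - rewrite <- (comp_assoc (s1 _ _ ⊗₁ _)), sum_str_s1, comp_assoc, osumm_s1.
      rewrite <- (comp_assoc (str G (X ⊗ Y) Z)), <- comp_assoc, str_assocE.
      rewrite comp_assoc, <- sum_str_s1, <- !comp_assoc. f_equal.
      apply heq_eq. rewrite (heq_idl _ _ (assoc_heq _ _ _)), (heq_idr _ _ (assoc_heq _ _ _)).
      apply tensm_idm2. }
  apply eq_heq in H.
  assert (K : osumm (fmap F (assoc X Y Z)) (fmap G (assoc X Y Z))
              ≡ idm (F ((X ⊗ Y) ⊗ Z) ⊕ G ((X ⊗ Y) ⊗ Z))).
  { assert (K : forall (P Q : C) (u : hom P Q), u ≡ idm P ->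
               osumm (fmap F u) (fmap G u) ≡ idm (F P ⊕ G P)).
    { intros P Q u Hu. heq_destruct. rewrite !fmap_id. apply eq_heq, osum_ext;
        now rewrite ?osumm_s0, ?osumm_s1, comp_idl, comp_idr. }
    apply K, assoc_heq. }
  rewrite (heq_idr _ _ K), (heq_idl _ _ (assoc_heq _ _ _)) in H. exact H.
Qed.

Program Definition unit_scell F G (a : StrongNat F G) : scell F tunit tunit G :=
  @mk_scell C F tunit tunit G
    (fun X => hcast (eq_sym (tens1r (F X))) (f_equal G (eq_sym (tens1r X))) (a X)) _ _.
Next Obligation.
  intros; cbv beta.
  apply heq_eq.
  transitivity (mkArrow (fmap F f ;; a Y)).
  { apply comp_heq; [apply tensm_unitr|apply hcast_heq]. }
  rewrite ncomp_nat. symmetry.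
  apply comp_heq; [apply hcast_heq|apply fmap_heq, tensm_unitr].
Qed.
Next Obligation.
  intros; cbv beta.
  apply heq_eq.
  transitivity (mkArrow ((a X ⊗₁ idm Y) ;; (str G X Y ;; fmap G (idm (X ⊗ Y))))).
  { apply comp_heq; [apply tensm_heq; [apply hcast_heq|reflexivity]|].
    apply comp_heq; [apply str_heq; auto; apply tens1r|apply fmap_heq, swap_mid]. }
  rewrite fmap_id, comp_idr, ncomp_str. symmetry.
  rewrite (heq_idl _ _ (swap_mid _ _)).
  apply comp_heq; [apply tensm_unitr|apply hcast_heq].
Qed.

Program Definition nat_p0 F G : StrongNat (prodSF F G) F :=
  {| ncomp := (fun X => p0 (F X) (G X)) : forall X, hom (prodSF F G X) (F X) |}.
Next Obligation.
  intros; simpl.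
  apply tensm_p0.
Qed.
Next Obligation.
  intros; simpl.
  now rewrite prod_strE, pairing_p0.
Qed.

Program Definition nat_p1 F G : StrongNat (prodSF F G) G :=
  {| ncomp := (fun X => p1 (F X) (G X)) : forall X, hom (prodSF F G X) (G X) |}.
Next Obligation.
  intros; simpl.
  apply tensm_p1.
Qed.
Next Obligation.
  intros; simpl.
  now rewrite prod_strE, pairing_p1.
Qed.

Program Definition nat_s0 F G : StrongNat F (sumSF F G) :=
  {| ncomp := (fun X => s0 (F X) (G X)) : forall X, hom (F X) (sumSF F G X) |}.
Next Obligation.
  intros; simpl.
  now rewrite osumm_s0.
Qed.
Next Obligation.
  intros; simpl.
  apply sum_str_s0.
Qed.

Program Definition nat_s1 F G : StrongNat G (sumSF F G) :=
  {| ncomp := (fun X => s1 (F X) (G X)) : forall X, hom (G X) (sumSF F G X) |}.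
Next Obligation.
  intros; simpl.
  now rewrite osumm_s1.
Qed.
Next Obligation.
  intros; simpl.
  apply sum_str_s1.
Qed.

Definition s_pi0 F G : scell (prodSF F G) tunit tunit F := unit_scell (nat_p0 F G).
Definition s_pi1 F G : scell (prodSF F G) tunit tunit G := unit_scell (nat_p1 F G).
Definition s_iota0 F G : scell F tunit tunit (sumSF F G) := unit_scell (nat_s0 F G).
Definition s_iota1 F G : scell G tunit tunit (sumSF F G) := unit_scell (nat_s1 F G).

Program Definition s_times {V A B U W} (α : scell V A B U) (β : scell V A B W) :
  scell V A B (prodSF U W) :=
  @mk_scell C V A B (prodSF U W) (fun X => ⟨scomp α X, scomp β X⟩) _ _.
Next Obligation.
  intros; cbv beta.
  simpl. rewrite pairing_comp, pairing_tensm. f_equal; apply scomp_nat.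
Qed.
Next Obligation.
  intros; cbv beta.
  simpl. rewrite prod_strE, !pairing_tensm, !pairing_comp.
  f_equal; rewrite <- scomp_str, <- !comp_assoc, <- !tensm_compl, ?pairing_p0, ?pairing_p1;
    reflexivity.
Qed.

Program Definition s_plus {U A B V W} (α : scell U A B V) (β : scell W A B V) :
  scell (sumSF U W) A B V :=
  @mk_scell C (sumSF U W) A B V
    (fun X => distr (U X) (W X) A ;; copairing (scomp α X) (scomp β X)) _ _.
Next Obligation.
  intros; cbv beta.
  simpl. apply distr_ext.
  + rewrite <- !comp_assoc, tensm_comp, osumm_s0, s0_distr, comp_idl, tensm_compl.
    rewrite (comp_assoc _ _ (distr _ _ _)), s0_distr, comp_assoc, !copairing_s0. apply scomp_nat.
  + rewrite <- !comp_assoc, tensm_comp, osumm_s1, s1_distr, comp_idl, tensm_compl.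
    rewrite (comp_assoc _ _ (distr _ _ _)), s1_distr, comp_assoc, !copairing_s1. apply scomp_nat.
Qed.
Next Obligation.
  intros; cbv beta.
  simpl. apply distr_ext2.
  + rewrite <- !comp_assoc, <- tensm_compl, <- comp_assoc, s0_distr, copairing_s0.
    rewrite swap_nat, !comp_assoc, scomp_str. f_equal.
    rewrite <- !comp_assoc, <- tensm_compl, sum_str_s0, tensm_compl.
    now rewrite (comp_assoc _ _ (distr _ _ _)), s0_distr, comp_assoc, copairing_s0.
  + rewrite <- !comp_assoc, <- tensm_compl, <- comp_assoc, s1_distr, copairing_s1.
    rewrite swap_nat, !comp_assoc, scomp_str. f_equal.
    rewrite <- !comp_assoc, <- tensm_compl, sum_str_s1, tensm_compl.
    now rewrite (comp_assoc _ _ (distr _ _ _)), s1_distr, comp_assoc, copairing_s1.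
Qed.

Program Definition s_case {U A B D W} (α : scell U A D W) (β : scell U B D W) :
  scell U (A ⊕ B) D W :=
  @mk_scell C U (A ⊕ B) D W
    (fun X => distl A B (U X) ;; copairing (scomp α X) (scomp β X)) _ _.
Next Obligation.
  intros; cbv beta.
  apply distl_ext.
  + rewrite <- !comp_assoc, tensm_comp, s0_distl, copairing_s0, comp_idl, comp_idr.
    rewrite <- (comp_idl (s0 A B)), <- (comp_idr (fmap U f)), <- tensm_comp.
    rewrite (comp_assoc _ _ (distl _ _ _)), s0_distl, comp_assoc, copairing_s0.
    apply scomp_nat.
  + rewrite <- !comp_assoc, tensm_comp, s1_distl, copairing_s1, comp_idl, comp_idr.
    rewrite <- (comp_idl (s1 A B)), <- (comp_idr (fmap U f)), <- tensm_comp.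
    rewrite (comp_assoc _ _ (distl _ _ _)), s1_distl, comp_assoc, copairing_s1.
    apply scomp_nat.
Qed.
Next Obligation.
  intros; cbv beta.
  apply distl_ext2.
  + rewrite <- !comp_assoc, <- tensm_compl, <- comp_assoc, s0_distl, copairing_s0.
    rewrite swap_nat, !comp_assoc, scomp_str. f_equal.
    rewrite <- !comp_assoc, tensm_comp, tensm_id, comp_idl, comp_idr.
    rewrite <- (comp_idl (s0 A B)), <- (comp_idr (str U X Y)), <- tensm_comp.
    now rewrite (comp_assoc _ _ (distl _ _ _)), s0_distl, comp_assoc, copairing_s0, comp_idr.
  + rewrite <- !comp_assoc, <- tensm_compl, <- comp_assoc, s1_distl, copairing_s1.
    rewrite swap_nat, !comp_assoc, scomp_str. f_equal.
    rewrite <- !comp_assoc, tensm_comp, tensm_id, comp_idl, comp_idr.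
    rewrite <- (comp_idl (s1 A B)), <- (comp_idr (str U X Y)), <- tensm_comp.
    now rewrite (comp_assoc _ _ (distl _ _ _)), s1_distl, comp_assoc, copairing_s1, comp_idr.
Qed.
End Choice.

(* The quotient by an equivalence relation [R], as the type of its classes. *)
Definition quot {T : Type} (R : T -> T -> Prop) : Type := {P : T -> Prop | exists x, P = R x}.

Definition cls {T : Type} (R : T -> T -> Prop) (x : T) : quot R :=
  exist _ (R x) (ex_intro _ x eq_refl).

Definition repr {T : Type} {R : T -> T -> Prop} (q : quot R) : T :=
  proj1_sig (constructive_indefinite_description _ (proj2_sig q)).

Lemma cls_repr {T} (R : T -> T -> Prop) (q : quot R) : cls R (repr q) = q.
Proof.
  unfold repr. destruct (constructive_indefinite_description _ _) as [x Hx]. simpl.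
  destruct q as [P HP]. simpl in *. subst. unfold cls. f_equal. apply proof_irrelevance.
Qed.

Lemma quot_ind {T} (R : T -> T -> Prop) (P : quot R -> Prop) :
  (forall x, P (cls R x)) -> forall q, P q.
Proof. intros H q. rewrite <- cls_repr. apply H. Qed.

Record equivalence {T : Type} (R : T -> T -> Prop) : Prop := {
  equiv_refl : forall x, R x x;
  equiv_sym : forall x y, R x y -> R y x;
  equiv_trans : forall x y z, R x y -> R y z -> R x z
}.

Lemma cls_eq {T} (R : T -> T -> Prop) (ER : equivalence R) x y : R x y -> cls R x = cls R y.
Proof.
  intros H. assert (E : R x = R y).
  { extensionality z. apply propositional_extensionality.
    destruct ER as [_ Hs Ht]. split; eauto. }
  apply eq_sig_hprop; [intros; apply proof_irrelevance|exact E].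
Qed.

Lemma eq_cls {T} (R : T -> T -> Prop) (ER : equivalence R) x y : cls R x = cls R y -> R x y.
Proof.
  intros H. apply (f_equal (@proj1_sig _ _)) in H. simpl in H. rewrite H. apply (equiv_refl ER).
Qed.

Lemma repr_cls {T} (R : T -> T -> Prop) (ER : equivalence R) x : R (repr (cls R x)) x.
Proof. apply eq_cls; auto. apply cls_repr. Qed.

Section SquareLemmas.
Context {V H : Type} {cell : V -> H -> H -> V -> Type}.

Definition ccast {U U' A A' B B' W W'} (eU : U = U') (eA : A = A') (eB : B = B') (eW : W = W')
  (α : cell U A B W) : cell U' A' B' W' :=
  match eU in _ = u, eA in _ = a, eB in _ = b, eW in _ = w return cell u a b w with
  | eq_refl, eq_refl, eq_refl, eq_refl => α
  end.

Lemma ccast_heq U U' A A' B B' W W' (eU : U = U') (eA : A = A') (eB : B = B') (eW : W = W')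
  (α : cell U A B W) : ccast eU eA eB eW α ≋ α.
Proof. destruct eU, eA, eB, eW. reflexivity. Qed.

Lemma sq_eq U A B W (α β : cell U A B W) : α ≋ β -> α = β.
Proof.
  intros E. inversion E as [E1]. do 4 apply inj_pair2 in E1. exact E1.
Qed.

Lemma sq_boundary U A B W U' A' B' W' (α : cell U A B W) (β : cell U' A' B' W') :
  α ≋ β -> U = U' /\ A = A' /\ B = B' /\ W = W'.
Proof. intros E. now inversion E. Qed.

Lemma cls_sq (R : Square cell -> Square cell -> Prop) (ER : equivalence R)
  U A B W U' A' B' W' (α : cell U A B W) (β : cell U' A' B' W') :
  U = U' -> A = A' -> B = B' -> W = W' -> R (mkSquare α) (mkSquare β) ->
  mkSquare (cell := fun u a b w => quot (fun x y : cell u a b w => R (mkSquare x) (mkSquare y)))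
    (cls _ α) = mkSquare (cls _ β).
Proof.
  intros -> -> -> -> E. f_equal. apply cls_eq; auto.
  destruct ER. split; eauto.
Qed.
End SquareLemmas.
Arguments ccast : simpl never.

Ltac sq_destruct :=
  repeat match goal with
  | E : mkSquare _ = mkSquare _ |- _ =>
      let a := fresh in let b := fresh in let c := fresh in let d := fresh in
      destruct (sq_boundary E) as (a & b & c & d); subst; apply sq_eq in E; subst
  end.

Section CellLemmas.
Context {E : DoubleCategory}.

Lemma hcomp_sq (U : VE E) A B V A' B' W X C D Y C' D' Z
  (α : @cell E U A B V) (β : @cell E V A' B' W) (α' : @cell E X C D Y) (β' : @cell E Y C' D' Z) :
  α ≋ α' -> β ≋ β' -> hcomp α β ≋ hcomp α' β'.
Proof. intros. sq_destruct. reflexivity. Qed.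

Lemma vcomp_sq (U : VE E) A D W U' B W' X K L Y X' M Y'
  (α : @cell E U A D W) (β : @cell E U' D B W') (α' : @cell E X K L Y) (β' : @cell E X' L M Y') :
  α ≋ α' -> β ≋ β' -> vcomp α β ≋ vcomp α' β'.
Proof. intros. sq_destruct. reflexivity. Qed.

Lemma hid_sq (U W : VE E) : U = W -> hid U ≋ hid W.
Proof. intros ->. reflexivity. Qed.

Lemma vid_sq (A B : HE E) : A = B -> vid A ≋ vid B.
Proof. intros ->. reflexivity. Qed.
End CellLemmas.

Inductive port (C : CartCategory) : Type :=
| circ (A : C)
| bullet (A : C).
Arguments circ {C} A.
Arguments bullet {C} A.

Definition list_monoid (T : Type) : Monoid :=
  {| mcarrier := list T; mop := @app T; munit := nil;
     mopA := fun x y z => eq_sym (app_assoc x y z);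
     mop1l := fun x => eq_refl; mop1r := @app_nil_r T |}.

Inductive fc_term {C : CartCategory} : list (port C) -> C -> C -> list (port C) -> Type :=
| fc_hid U : fc_term U tunit tunit U
| fc_vid A : fc_term [] A A []
| fc_hcomp U A B V A' B' W (x : fc_term U A B V) (y : fc_term V A' B' W) :
    fc_term U (A ⊗ A') (B ⊗ B') W
| fc_vcomp U A D W U' B W' (x : fc_term U A D W) (y : fc_term U' D B W') :
    fc_term (U ++ U') A B (W ++ W')
| fc_mor A B (f : hom A B) : fc_term [] A B []
| fc_getL A : fc_term [circ A] tunit A []
| fc_putR A : fc_term [] A tunit [circ A]
| fc_getR A : fc_term [] tunit A [bullet A]
| fc_putL A : fc_term [bullet A] A tunit [].
Arguments fc_hcomp {C U A B V A' B' W} x y.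
Arguments fc_vcomp {C U A D W U' B W'} x y.
Arguments fc_mor {C A B} f.

Reserved Notation "x ≈ y" (at level 70, no associativity).

(* The least congruence making the terms a single-object double category in
   which the equations between the generators hold.  It relates squares rather
   than terms because the double category laws are equations between terms whose
   boundaries are only propositionally equal. *)
Inductive fc_eq {C : CartCategory} : Square (@fc_term C) -> Square (@fc_term C) -> Prop :=
| fc_refl s : fc_eq s s
| fc_sym s t : fc_eq s t -> fc_eq t s
| fc_trans s t u : fc_eq s t -> fc_eq t u -> fc_eq s u
| fc_hcomp_cong U A B V A' B' W U1 A1 B1 V1 A1' B1' W1
    (x : fc_term U A B V) (y : fc_term V A' B' W)
    (x1 : fc_term U1 A1 B1 V1) (y1 : fc_term V1 A1' B1' W1) :
    x ≈ x1 -> y ≈ y1 -> fc_hcomp x y ≈ fc_hcomp x1 y1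
| fc_vcomp_cong U A D W U' B W' U1 A1 D1 W1 U1' B1 W1'
    (x : fc_term U A D W) (y : fc_term U' D B W')
    (x1 : fc_term U1 A1 D1 W1) (y1 : fc_term U1' D1 B1 W1') :
    x ≈ x1 -> y ≈ y1 -> fc_vcomp x y ≈ fc_vcomp x1 y1
| fc_hcompA U A B V A' B' W A'' B'' Z
    (x : fc_term U A B V) (y : fc_term V A' B' W) (z : fc_term W A'' B'' Z) :
    fc_hcomp (fc_hcomp x y) z ≈ fc_hcomp x (fc_hcomp y z)
| fc_hcomp1l U A B W (x : fc_term U A B W) : fc_hcomp (fc_hid U) x ≈ x
| fc_hcomp1r U A B W (x : fc_term U A B W) : fc_hcomp x (fc_hid W) ≈ x
| fc_vcompA U A B W U' D W' U'' E W''
    (x : fc_term U A B W) (y : fc_term U' B D W') (z : fc_term U'' D E W'') :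
    fc_vcomp (fc_vcomp x y) z ≈ fc_vcomp x (fc_vcomp y z)
| fc_vcomp1l U A B W (x : fc_term U A B W) : fc_vcomp (fc_vid A) x ≈ x
| fc_vcomp1r U A B W (x : fc_term U A B W) : fc_vcomp x (fc_vid B) ≈ x
| fc_hid_unit : fc_hid [] ≈ fc_vid tunit
| fc_vid_tens A B : fc_vid (A ⊗ B) ≈ fc_hcomp (fc_vid A) (fc_vid B)
| fc_hid_app U W : fc_hid (U ++ W) ≈ fc_vcomp (fc_hid U) (fc_hid W)
| fc_interchange U A B V A' B' W U' D V' D' W'
    (x : fc_term U A B V) (y : fc_term V A' B' W)
    (z : fc_term U' B D V') (w : fc_term V' B' D' W') :
    fc_vcomp (fc_hcomp x y) (fc_hcomp z w) ≈ fc_hcomp (fc_vcomp x z) (fc_vcomp y w)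
| fc_mor_comp A B D (f : hom A B) (g : hom B D) :
    fc_mor (f ;; g) ≈ fc_vcomp (fc_mor f) (fc_mor g)
| fc_mor_id A : fc_mor (idm A) ≈ fc_vid A
| fc_mor_tens A A' B B' (f : hom A A') (g : hom B B') :
    fc_mor (f ⊗₁ g) ≈ fc_hcomp (fc_mor f) (fc_mor g)
| fc_putR_getL A : fc_hcomp (fc_putR A) (fc_getL A) ≈ fc_vid A
| fc_getL_putR A : fc_vcomp (fc_getL A) (fc_putR A) ≈ fc_hid [circ A]
| fc_getR_putL A : fc_hcomp (fc_getR A) (fc_putL A) ≈ fc_vid A
| fc_getR_putL_v A : fc_vcomp (fc_getR A) (fc_putL A) ≈ fc_hid [bullet A]
where "x ≈ y" := (fc_eq (mkSquare x) (mkSquare y)).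

Definition fc_cell {C : CartCategory} (U : list (port C)) (A B : C) (W : list (port C)) : Type :=
  quot (fun x y : fc_term U A B W => fc_eq (mkSquare x) (mkSquare y)).

Definition fc_cls {C : CartCategory} {U A B W} (x : @fc_term C U A B W) : fc_cell U A B W :=
  cls _ x.

Section FreeCornering.
Context {C : CartCategory}.

Lemma fc_equiv : equivalence (@fc_eq C).
Proof. split; eauto using fc_refl, fc_sym, fc_trans. Qed.

Lemma fc_equiv_at U A B W :
  equivalence (fun x y : @fc_term C U A B W => fc_eq (mkSquare x) (mkSquare y)).
Proof. split; eauto using fc_refl, fc_sym, fc_trans. Qed.

Lemma fc_ind U A B W (P : @fc_cell C U A B W -> Prop) :
  (forall x, P (fc_cls x)) -> forall α, P α.
Proof. apply quot_ind. Qed.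

Lemma fc_cls_sq U A B W U' A' B' W' (x : @fc_term C U A B W) (y : @fc_term C U' A' B' W') :
  U = U' -> A = A' -> B = B' -> W = W' -> fc_eq (mkSquare x) (mkSquare y) ->
  mkSquare (cell := @fc_cell C) (fc_cls x) = mkSquare (fc_cls y).
Proof. apply (cls_sq fc_equiv). Qed.

Lemma fc_cls_eq U A B W (x y : @fc_term C U A B W) :
  fc_eq (mkSquare x) (mkSquare y) -> fc_cls x = fc_cls y.
Proof. apply (cls_eq (fc_equiv_at U A B W)). Qed.

Definition fcq_hcomp {U A B V A' B' W} (α : @fc_cell C U A B V) (β : @fc_cell C V A' B' W) :
  fc_cell U (A ⊗ A') (B ⊗ B') W := fc_cls (fc_hcomp (repr α) (repr β)).

Definition fcq_vcomp {U A D W U' B W'} (α : @fc_cell C U A D W) (β : @fc_cell C U' D B W') :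
  fc_cell (U ++ U') A B (W ++ W') := fc_cls (fc_vcomp (repr α) (repr β)).

Lemma fcq_hcompE U A B V A' B' W (x : @fc_term C U A B V) (y : @fc_term C V A' B' W) :
  fcq_hcomp (fc_cls x) (fc_cls y) = fc_cls (fc_hcomp x y).
Proof. apply fc_cls_eq, fc_hcomp_cong; apply (repr_cls (fc_equiv_at _ _ _ _)). Qed.

Lemma fcq_vcompE U A D W U' B W' (x : @fc_term C U A D W) (y : @fc_term C U' D B W') :
  fcq_vcomp (fc_cls x) (fc_cls y) = fc_cls (fc_vcomp x y).
Proof. apply fc_cls_eq, fc_vcomp_cong; apply (repr_cls (fc_equiv_at _ _ _ _)). Qed.
End FreeCornering.

Ltac fc_start :=
  repeat match goal with α : @fc_cell _ _ _ _ _ |- _ => revert α; apply fc_ind; intros α end;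
  rewrite ?fcq_hcompE, ?fcq_vcompE, ?fcq_hcompE, ?fcq_vcompE.

Program Definition free_cornering (C : CartCategory) : DoubleCategory :=
  {| HE := tens_monoid C; VE := list_monoid (port C); cell := @fc_cell C;
            hcomp := @fcq_hcomp C; vcomp := @fcq_vcomp C;
            hid := fun U => fc_cls (fc_hid U); vid := fun A => fc_cls (fc_vid A) |}.
Next Obligation.
  cbn [mcarrier mop munit tens_monoid list_monoid]; intros; fc_start.
  apply fc_cls_sq; auto using tensA. apply fc_hcompA.
Qed.
Next Obligation.
  cbn [mcarrier mop munit tens_monoid list_monoid]; intros; fc_start.
  apply fc_cls_sq; auto using tens1l. apply fc_hcomp1l.
Qed.
Next Obligation.
  cbn [mcarrier mop munit tens_monoid list_monoid]; intros; fc_start.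
  apply fc_cls_sq; auto using tens1r. apply fc_hcomp1r.
Qed.
Next Obligation.
  cbn [mcarrier mop munit tens_monoid list_monoid]; intros; fc_start.
  apply fc_cls_sq; auto; try (symmetry; apply app_assoc). apply fc_vcompA.
Qed.
Next Obligation.
  cbn [mcarrier mop munit tens_monoid list_monoid]; intros; fc_start.
  apply fc_cls_sq; auto. apply fc_vcomp1l.
Qed.
Next Obligation.
  cbn [mcarrier mop munit tens_monoid list_monoid]; intros; fc_start.
  apply fc_cls_sq; auto using app_nil_r. apply fc_vcomp1r.
Qed.
Next Obligation.
  cbn [mcarrier mop munit tens_monoid list_monoid]; intros; fc_start.
  apply fc_cls_eq, fc_hid_unit.
Qed.
Next Obligation.
  cbn [mcarrier mop munit tens_monoid list_monoid]; intros; fc_start.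
  apply fc_cls_eq, fc_vid_tens.
Qed.
Next Obligation.
  cbn [mcarrier mop munit tens_monoid list_monoid]; intros; fc_start.
  apply fc_cls_eq, fc_hid_app.
Qed.
Next Obligation.
  cbn [mcarrier mop munit tens_monoid list_monoid]; intros; fc_start.
  apply fc_cls_eq, fc_interchange.
Qed.

(* The vertical edge monoid, generated by A°, A•, U × W and U + W subject only
   to associativity and unitality of ⊗, is the monoid of lists of the
   generating symbols; the arguments of × and + are again such lists. *)
Inductive cport (C : DistCCCategory) : Type :=
| ccirc (A : C)
| cbullet (A : C)
| cprod (U W : list (cport C))
| csum (U W : list (cport C)).
Arguments ccirc {C} A.
Arguments cbullet {C} A.
Arguments cprod {C} U W.
Arguments csum {C} U W.

Inductive fcc_term {C : DistCCCategory} : list (cport C) -> C -> C -> list (cport C) -> Type :=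
| fcc_hid U : fcc_term U tunit tunit U
| fcc_vid A : fcc_term [] A A []
| fcc_hcomp U A B V A' B' W (x : fcc_term U A B V) (y : fcc_term V A' B' W) :
    fcc_term U (A ⊗ A') (B ⊗ B') W
| fcc_vcomp U A D W U' B W' (x : fcc_term U A D W) (y : fcc_term U' D B W') :
    fcc_term (U ++ U') A B (W ++ W')
| fcc_mor A B (f : hom A B) : fcc_term [] A B []
| fcc_getL A : fcc_term [ccirc A] tunit A []
| fcc_putR A : fcc_term [] A tunit [ccirc A]
| fcc_getR A : fcc_term [] tunit A [cbullet A]
| fcc_putL A : fcc_term [cbullet A] A tunit []
| fcc_pi0 U W : fcc_term [cprod U W] tunit tunit U
| fcc_pi1 U W : fcc_term [cprod U W] tunit tunit W
| fcc_times V A B U W (x : fcc_term V A B U) (y : fcc_term V A B W) :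
    fcc_term V A B [cprod U W]
| fcc_iota0 U W : fcc_term U tunit tunit [csum U W]
| fcc_iota1 U W : fcc_term W tunit tunit [csum U W]
| fcc_plus U A B V W (x : fcc_term U A B V) (y : fcc_term W A B V) :
    fcc_term [csum U W] A B V
| fcc_case U A B D W (x : fcc_term U A D W) (y : fcc_term U B D W) :
    fcc_term U (A ⊕ B) D W.
Arguments fcc_hcomp {C U A B V A' B' W} x y.
Arguments fcc_vcomp {C U A D W U' B W'} x y.
Arguments fcc_mor {C A B} f.
Arguments fcc_times {C V A B U W} x y.
Arguments fcc_plus {C U A B V W} x y.
Arguments fcc_case {C U A B D W} x y.

Reserved Notation "x ≃ y" (at level 70, no associativity).

(* Uniqueness of [α × β], [α + β] and [α, β] is imposed by the rules
   [fcc_times_uniq], [fcc_plus_uniq] and [fcc_case_uniq], which have equations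
   as premises. *)
Inductive fcc_eq {C : DistCCCategory} : Square (@fcc_term C) -> Square (@fcc_term C) -> Prop :=
| fcc_refl s : fcc_eq s s
| fcc_sym s t : fcc_eq s t -> fcc_eq t s
| fcc_trans s t u : fcc_eq s t -> fcc_eq t u -> fcc_eq s u
| fcc_hcomp_cong U A B V A' B' W U1 A1 B1 V1 A1' B1' W1
    (x : fcc_term U A B V) (y : fcc_term V A' B' W)
    (x1 : fcc_term U1 A1 B1 V1) (y1 : fcc_term V1 A1' B1' W1) :
    x ≃ x1 -> y ≃ y1 -> fcc_hcomp x y ≃ fcc_hcomp x1 y1
| fcc_vcomp_cong U A D W U' B W' U1 A1 D1 W1 U1' B1 W1'
    (x : fcc_term U A D W) (y : fcc_term U' D B W')
    (x1 : fcc_term U1 A1 D1 W1) (y1 : fcc_term U1' D1 B1 W1') :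
    x ≃ x1 -> y ≃ y1 -> fcc_vcomp x y ≃ fcc_vcomp x1 y1
| fcc_times_cong V A B U W (x x1 : fcc_term V A B U) (y y1 : fcc_term V A B W) :
    x ≃ x1 -> y ≃ y1 -> fcc_times x y ≃ fcc_times x1 y1
| fcc_plus_cong U A B V W (x x1 : fcc_term U A B V) (y y1 : fcc_term W A B V) :
    x ≃ x1 -> y ≃ y1 -> fcc_plus x y ≃ fcc_plus x1 y1
| fcc_case_cong U A B D W (x x1 : fcc_term U A D W) (y y1 : fcc_term U B D W) :
    x ≃ x1 -> y ≃ y1 -> fcc_case x y ≃ fcc_case x1 y1
| fcc_hcompA U A B V A' B' W A'' B'' Z
    (x : fcc_term U A B V) (y : fcc_term V A' B' W) (z : fcc_term W A'' B'' Z) :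
    fcc_hcomp (fcc_hcomp x y) z ≃ fcc_hcomp x (fcc_hcomp y z)
| fcc_hcomp1l U A B W (x : fcc_term U A B W) : fcc_hcomp (fcc_hid U) x ≃ x
| fcc_hcomp1r U A B W (x : fcc_term U A B W) : fcc_hcomp x (fcc_hid W) ≃ x
| fcc_vcompA U A B W U' D W' U'' E W''
    (x : fcc_term U A B W) (y : fcc_term U' B D W') (z : fcc_term U'' D E W'') :
    fcc_vcomp (fcc_vcomp x y) z ≃ fcc_vcomp x (fcc_vcomp y z)
| fcc_vcomp1l U A B W (x : fcc_term U A B W) : fcc_vcomp (fcc_vid A) x ≃ x
| fcc_vcomp1r U A B W (x : fcc_term U A B W) : fcc_vcomp x (fcc_vid B) ≃ x
| fcc_hid_unit : fcc_hid [] ≃ fcc_vid tunit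
| fcc_vid_tens A B : fcc_vid (A ⊗ B) ≃ fcc_hcomp (fcc_vid A) (fcc_vid B)
| fcc_hid_app U W : fcc_hid (U ++ W) ≃ fcc_vcomp (fcc_hid U) (fcc_hid W)
| fcc_interchange U A B V A' B' W U' D V' D' W'
    (x : fcc_term U A B V) (y : fcc_term V A' B' W)
    (z : fcc_term U' B D V') (w : fcc_term V' B' D' W') :
    fcc_vcomp (fcc_hcomp x y) (fcc_hcomp z w) ≃ fcc_hcomp (fcc_vcomp x z) (fcc_vcomp y w)
| fcc_mor_comp A B D (f : hom A B) (g : hom B D) :
    fcc_mor (f ;; g) ≃ fcc_vcomp (fcc_mor f) (fcc_mor g)
| fcc_mor_id A : fcc_mor (idm A) ≃ fcc_vid A
| fcc_mor_tens A A' B B' (f : hom A A') (g : hom B B') :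
    fcc_mor (f ⊗₁ g) ≃ fcc_hcomp (fcc_mor f) (fcc_mor g)
| fcc_putR_getL A : fcc_hcomp (fcc_putR A) (fcc_getL A) ≃ fcc_vid A
| fcc_getL_putR A : fcc_vcomp (fcc_getL A) (fcc_putR A) ≃ fcc_hid [ccirc A]
| fcc_getR_putL A : fcc_hcomp (fcc_getR A) (fcc_putL A) ≃ fcc_vid A
| fcc_getR_putL_v A : fcc_vcomp (fcc_getR A) (fcc_putL A) ≃ fcc_hid [cbullet A]
| fcc_times_pi0 V A B U W (x : fcc_term V A B U) (y : fcc_term V A B W) :
    fcc_hcomp (fcc_times x y) (fcc_pi0 U W) ≃ x
| fcc_times_pi1 V A B U W (x : fcc_term V A B U) (y : fcc_term V A B W) :
    fcc_hcomp (fcc_times x y) (fcc_pi1 U W) ≃ y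
| fcc_times_uniq V A B U W (x : fcc_term V A B U) (y : fcc_term V A B W)
    (z : fcc_term V A B [cprod U W]) :
    fcc_hcomp z (fcc_pi0 U W) ≃ x -> fcc_hcomp z (fcc_pi1 U W) ≃ y -> z ≃ fcc_times x y
| fcc_iota0_plus U A B V W (x : fcc_term U A B V) (y : fcc_term W A B V) :
    fcc_hcomp (fcc_iota0 U W) (fcc_plus x y) ≃ x
| fcc_iota1_plus U A B V W (x : fcc_term U A B V) (y : fcc_term W A B V) :
    fcc_hcomp (fcc_iota1 U W) (fcc_plus x y) ≃ y
| fcc_plus_uniq U A B V W (x : fcc_term U A B V) (y : fcc_term W A B V)
    (z : fcc_term [csum U W] A B V) :
    fcc_hcomp (fcc_iota0 U W) z ≃ x -> fcc_hcomp (fcc_iota1 U W) z ≃ y -> z ≃ fcc_plus x y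
| fcc_s0_case U A B D W (x : fcc_term U A D W) (y : fcc_term U B D W) :
    fcc_vcomp (fcc_mor (s0 A B)) (fcc_case x y) ≃ x
| fcc_s1_case U A B D W (x : fcc_term U A D W) (y : fcc_term U B D W) :
    fcc_vcomp (fcc_mor (s1 A B)) (fcc_case x y) ≃ y
| fcc_case_uniq U A B D W (x : fcc_term U A D W) (y : fcc_term U B D W)
    (z : fcc_term U (A ⊕ B) D W) :
    fcc_vcomp (fcc_mor (s0 A B)) z ≃ x -> fcc_vcomp (fcc_mor (s1 A B)) z ≃ y ->
    z ≃ fcc_case x y
where "x ≃ y" := (fcc_eq (mkSquare x) (mkSquare y)).

Definition fcc_cell {C : DistCCCategory} (U : list (cport C)) (A B : C) (W : list (cport C)) : Type :=
  quot (fun x y : fcc_term U A B W => fcc_eq (mkSquare x) (mkSquare y)).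

Definition fcc_cls {C : DistCCCategory} {U A B W} (x : @fcc_term C U A B W) : fcc_cell U A B W :=
  cls _ x.

Section FreeCorneringChoice.
Context {C : DistCCCategory}.

Lemma fcc_equiv : equivalence (@fcc_eq C).
Proof. split; eauto using fcc_refl, fcc_sym, fcc_trans. Qed.

Lemma fcc_equiv_at U A B W :
  equivalence (fun x y : @fcc_term C U A B W => fcc_eq (mkSquare x) (mkSquare y)).
Proof. split; eauto using fcc_refl, fcc_sym, fcc_trans. Qed.

Lemma fcc_ind U A B W (P : @fcc_cell C U A B W -> Prop) :
  (forall x, P (fcc_cls x)) -> forall α, P α.
Proof. apply quot_ind. Qed.

Lemma fcc_cls_sq U A B W U' A' B' W' (x : @fcc_term C U A B W) (y : @fcc_term C U' A' B' W') :
  U = U' -> A = A' -> B = B' -> W = W' -> fcc_eq (mkSquare x) (mkSquare y) ->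
  mkSquare (cell := @fcc_cell C) (fcc_cls x) = mkSquare (fcc_cls y).
Proof. apply (cls_sq fcc_equiv). Qed.

Lemma fcc_cls_eq U A B W (x y : @fcc_term C U A B W) :
  fcc_eq (mkSquare x) (mkSquare y) -> fcc_cls x = fcc_cls y.
Proof. apply (cls_eq (fcc_equiv_at U A B W)). Qed.

Definition fccq_hcomp {U A B V A' B' W} (α : @fcc_cell C U A B V) (β : @fcc_cell C V A' B' W) :
  fcc_cell U (A ⊗ A') (B ⊗ B') W := fcc_cls (fcc_hcomp (repr α) (repr β)).

Definition fccq_vcomp {U A D W U' B W'} (α : @fcc_cell C U A D W) (β : @fcc_cell C U' D B W') :
  fcc_cell (U ++ U') A B (W ++ W') := fcc_cls (fcc_vcomp (repr α) (repr β)).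

Lemma fccq_hcompE U A B V A' B' W (x : @fcc_term C U A B V) (y : @fcc_term C V A' B' W) :
  fccq_hcomp (fcc_cls x) (fcc_cls y) = fcc_cls (fcc_hcomp x y).
Proof. apply fcc_cls_eq, fcc_hcomp_cong; apply (repr_cls (fcc_equiv_at _ _ _ _)). Qed.

Lemma fccq_vcompE U A D W U' B W' (x : @fcc_term C U A D W) (y : @fcc_term C U' D B W') :
  fccq_vcomp (fcc_cls x) (fcc_cls y) = fcc_cls (fcc_vcomp x y).
Proof. apply fcc_cls_eq, fcc_vcomp_cong; apply (repr_cls (fcc_equiv_at _ _ _ _)). Qed.
End FreeCorneringChoice.

Ltac fcc_start :=
  repeat match goal with α : @fcc_cell _ _ _ _ _ |- _ => revert α; apply fcc_ind; intros α end;
  rewrite ?fccq_hcompE, ?fccq_vcompE, ?fccq_hcompE, ?fccq_vcompE.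

Program Definition free_cornering_choice (C : DistCCCategory) : DoubleCategory :=
  {| HE := tens_monoid C; VE := list_monoid (cport C); cell := @fcc_cell C;
            hcomp := @fccq_hcomp C; vcomp := @fccq_vcomp C;
            hid := fun U => fcc_cls (fcc_hid U); vid := fun A => fcc_cls (fcc_vid A) |}.
Next Obligation.
  cbn [mcarrier mop munit tens_monoid list_monoid]; intros; fcc_start.
  apply fcc_cls_sq; auto using tensA. apply fcc_hcompA.
Qed.
Next Obligation.
  cbn [mcarrier mop munit tens_monoid list_monoid]; intros; fcc_start.
  apply fcc_cls_sq; auto using tens1l. apply fcc_hcomp1l.
Qed.
Next Obligation.
  cbn [mcarrier mop munit tens_monoid list_monoid]; intros; fcc_start.
  apply fcc_cls_sq; auto using tens1r. apply fcc_hcomp1r.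
Qed.
Next Obligation.
  cbn [mcarrier mop munit tens_monoid list_monoid]; intros; fcc_start.
  apply fcc_cls_sq; auto; try (symmetry; apply app_assoc). apply fcc_vcompA.
Qed.
Next Obligation.
  cbn [mcarrier mop munit tens_monoid list_monoid]; intros; fcc_start.
  apply fcc_cls_sq; auto. apply fcc_vcomp1l.
Qed.
Next Obligation.
  cbn [mcarrier mop munit tens_monoid list_monoid]; intros; fcc_start.
  apply fcc_cls_sq; auto using app_nil_r. apply fcc_vcomp1r.
Qed.
Next Obligation.
  cbn [mcarrier mop munit tens_monoid list_monoid]; intros; fcc_start.
  apply fcc_cls_eq, fcc_hid_unit.
Qed.
Next Obligation.
  cbn [mcarrier mop munit tens_monoid list_monoid]; intros; fcc_start.
  apply fcc_cls_eq, fcc_vid_tens.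
Qed.
Next Obligation.
  cbn [mcarrier mop munit tens_monoid list_monoid]; intros; fcc_start.
  apply fcc_cls_eq, fcc_hid_app.
Qed.
Next Obligation.
  cbn [mcarrier mop munit tens_monoid list_monoid]; intros; fcc_start.
  apply fcc_cls_eq, fcc_interchange.
Qed.

Lemma cmap_sq {D E : DoubleCategory} (F : DoubleFunctor D E) U A B W U' A' B' W'
  (α : @cell D U A B W) (β : @cell D U' A' B' W') : α ≋ β -> cmap F α ≋ cmap F β.
Proof. intros. sq_destruct. reflexivity. Qed.

Program Definition compDF {D E K : DoubleCategory} (F : DoubleFunctor D E) (G : DoubleFunctor E K) :
  DoubleFunctor D K :=
  {| hmap := fun A => hmap G (hmap F A);
            vmap := fun U => vmap G (vmap F U);
            cmap := fun U A B W α => cmap G (cmap F α) |}.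
Next Obligation.
  intros; cbv beta.
  intros. now rewrite !hmap_mop.
Qed.
Next Obligation.
  intros; cbv beta.
  now rewrite !hmap_munit.
Qed.
Next Obligation.
  intros; cbv beta.
  intros. now rewrite !vmap_mop.
Qed.
Next Obligation.
  intros; cbv beta.
  now rewrite !vmap_munit.
Qed.
Next Obligation.
  intros; cbv beta.
  intros. etransitivity; [apply cmap_sq, cmap_hcomp|apply cmap_hcomp].
Qed.
Next Obligation.
  intros; cbv beta.
  intros. etransitivity; [apply cmap_sq, cmap_vcomp|apply cmap_vcomp].
Qed.
Next Obligation.
  intros; cbv beta.
  intros. etransitivity; [apply cmap_sq, cmap_hid|apply cmap_hid].
Qed.
Next Obligation.
  intros; cbv beta.
  intros. etransitivity; [apply cmap_sq, cmap_vid|apply cmap_vid].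
Qed.

Lemma DoubleFunctor_eq {D E : DoubleCategory} (F G : DoubleFunctor D E) :
  (forall A, hmap F A = hmap G A) -> (forall U, vmap F U = vmap G U) ->
  (forall U A B W (α : cell U A B W), cmap F α ≋ cmap G α) -> F = G.
Proof.
  destruct F as [h v c], G as [h' v' c']. simpl. intros Hh Hv Hc.
  assert (h = h') by (extensionality A; apply Hh).
  assert (v = v') by (extensionality U; apply Hv).
  subst.
  assert (c = c').
  { extensionality U. extensionality A. extensionality B. extensionality W.
    extensionality α. apply sq_eq, Hc. }
  subst. f_equal; apply proof_irrelevance.
Qed.

Record CorneringModel (C : CartCategory) (E : DoubleCategory) := {
  cm_h : C -> HE E;
  cm_h_tens : forall A B, cm_h (A ⊗ B) = mop (cm_h A) (cm_h B);
  cm_h_unit : cm_h tunit = munit;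
  cm_port : port C -> VE E;
  cm_mor : forall {A B}, hom A B -> cell munit (cm_h A) (cm_h B) munit;
  cm_getL : forall A, cell (cm_port (circ A)) munit (cm_h A) munit;
  cm_putR : forall A, cell munit (cm_h A) munit (cm_port (circ A));
  cm_getR : forall A, cell munit munit (cm_h A) (cm_port (bullet A));
  cm_putL : forall A, cell (cm_port (bullet A)) (cm_h A) munit munit;
  cm_mor_comp : forall A B D (f : hom A B) (g : hom B D),
    cm_mor (f ;; g) ≋ vcomp (cm_mor f) (cm_mor g);
  cm_mor_id : forall A, cm_mor (idm A) ≋ vid (cm_h A);
  cm_mor_tens : forall A A' B B' (f : hom A A') (g : hom B B'),
    cm_mor (f ⊗₁ g) ≋ hcomp (cm_mor f) (cm_mor g);
  cm_putR_getL : forall A, hcomp (cm_putR A) (cm_getL A) ≋ vid (cm_h A);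
  cm_getL_putR : forall A, vcomp (cm_getL A) (cm_putR A) ≋ hid (cm_port (circ A));
  cm_getR_putL : forall A, hcomp (cm_getR A) (cm_putL A) ≋ vid (cm_h A);
  cm_getR_putL_v : forall A, vcomp (cm_getR A) (cm_putL A) ≋ hid (cm_port (bullet A))
}.

Section Rec.
Context {C : CartCategory} {E : DoubleCategory} (M : CorneringModel C E).

Definition rec_v (U : list (port C)) : VE E :=
  fold_right (fun p V => mop (cm_port M p) V) munit U.

Lemma rec_v_app U W : rec_v (U ++ W) = mop (rec_v U) (rec_v W).
Proof.
  induction U as [|p U IH]; simpl; [now rewrite mop1l|]. now rewrite IH, mopA.
Qed.

Lemma rec_v1 p : cm_port M p = rec_v [p].
Proof. symmetry. apply mop1r. Qed.

Let hu := eq_sym (cm_h_unit M).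

Fixpoint rec_term {U A B W} (x : @fc_term C U A B W) :
  @cell E (rec_v U) (cm_h M A) (cm_h M B) (rec_v W) :=
  match x in fc_term u a b w return @cell E (rec_v u) (cm_h M a) (cm_h M b) (rec_v w) with
  | fc_hid U => ccast eq_refl hu hu eq_refl (hid (rec_v U))
  | fc_vid A => vid (cm_h M A)
  | @fc_hcomp _ U A B V A' B' W x y =>
      ccast eq_refl (eq_sym (cm_h_tens M A A')) (eq_sym (cm_h_tens M B B')) eq_refl
        (hcomp (rec_term x) (rec_term y))
  | @fc_vcomp _ U A D W U' B W' x y =>
      ccast (eq_sym (rec_v_app U U')) eq_refl eq_refl (eq_sym (rec_v_app W W'))
        (vcomp (rec_term x) (rec_term y))
  | fc_mor f => cm_mor M f
  | fc_getL A => ccast (rec_v1 (circ A)) hu eq_refl eq_refl (cm_getL M A)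
  | fc_putR A => ccast eq_refl eq_refl hu (rec_v1 (circ A)) (cm_putR M A)
  | fc_getR A => ccast eq_refl hu eq_refl (rec_v1 (bullet A)) (cm_getR M A)
  | fc_putL A => ccast (rec_v1 (bullet A)) eq_refl hu eq_refl (cm_putL M A)
  end.

Lemma rec_hcomp U A B V A' B' W (x : @fc_term C U A B V) (y : @fc_term C V A' B' W) :
  rec_term (fc_hcomp x y) ≋ hcomp (rec_term x) (rec_term y).
Proof. apply ccast_heq. Qed.

Lemma rec_vcomp U A D W U' B W' (x : @fc_term C U A D W) (y : @fc_term C U' D B W') :
  rec_term (fc_vcomp x y) ≋ vcomp (rec_term x) (rec_term y).
Proof. apply ccast_heq. Qed.

Lemma rec_hid U : rec_term (fc_hid U) ≋ hid (rec_v U).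
Proof. apply ccast_heq. Qed.

Lemma rec_sound s t : fc_eq s t ->
  mkSquare (rec_term (sq_cell s)) = mkSquare (rec_term (sq_cell t)).
Proof.
  induction 1; cbn [sq_cell sq_left sq_top sq_bot sq_right] in *.
  - reflexivity.
  - now symmetry.
  - now etransitivity; eauto.
  - rewrite !rec_hcomp. now apply hcomp_sq.
  - rewrite !rec_vcomp. now apply vcomp_sq.
  - rewrite !rec_hcomp. etransitivity; [apply hcomp_sq; [apply rec_hcomp|reflexivity]|].
    rewrite hcompA. symmetry. apply hcomp_sq; [reflexivity|apply rec_hcomp].
  - rewrite !rec_hcomp. etransitivity; [apply hcomp_sq; [apply rec_hid|reflexivity]|].
    apply hcomp1l.
  - rewrite !rec_hcomp. etransitivity; [apply hcomp_sq; [reflexivity|apply rec_hid]|].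
    apply hcomp1r.
  - rewrite !rec_vcomp. etransitivity; [apply vcomp_sq; [apply rec_vcomp|reflexivity]|].
    rewrite vcompA. symmetry. apply vcomp_sq; [reflexivity|apply rec_vcomp].
  - rewrite !rec_vcomp. apply vcomp1l.
  - rewrite !rec_vcomp. apply vcomp1r.
  - rewrite rec_hid. cbn. rewrite hid_unit. apply vid_sq. symmetry. apply cm_h_unit.
  - rewrite rec_hcomp. cbn. rewrite <- vid_mop. apply vid_sq. apply cm_h_tens.
  - rewrite rec_vcomp, rec_hid. etransitivity; [apply hid_sq, rec_v_app|].
    rewrite hid_mop. symmetry. apply vcomp_sq; apply rec_hid.
  - rewrite rec_vcomp, rec_hcomp.
    etransitivity; [apply vcomp_sq; apply rec_hcomp|].
    rewrite interchange. symmetry. apply hcomp_sq; apply rec_vcomp.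
  - rewrite rec_vcomp. apply cm_mor_comp.
  - apply cm_mor_id.
  - rewrite rec_hcomp. apply cm_mor_tens.
  - rewrite rec_hcomp. etransitivity; [apply hcomp_sq; apply ccast_heq|]. apply cm_putR_getL.
  - rewrite rec_vcomp, rec_hid. etransitivity; [apply vcomp_sq; apply ccast_heq|].
    rewrite cm_getL_putR. apply hid_sq, rec_v1.
  - rewrite rec_hcomp. etransitivity; [apply hcomp_sq; apply ccast_heq|]. apply cm_getR_putL.
  - rewrite rec_vcomp, rec_hid. etransitivity; [apply vcomp_sq; apply ccast_heq|].
    rewrite cm_getR_putL_v. apply hid_sq, rec_v1.
Qed.

Definition rec_cell {U A B W} (α : @fc_cell C U A B W) :
  @cell E (rec_v U) (cm_h M A) (cm_h M B) (rec_v W) := rec_term (repr α).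

Lemma rec_cellE U A B W (x : @fc_term C U A B W) : rec_cell (fc_cls x) = rec_term x.
Proof. apply sq_eq, (rec_sound (repr_cls (fc_equiv_at U A B W) x)). Qed.

Program Definition cornering_rec : DoubleFunctor (free_cornering C) E :=
  @Build_DoubleFunctor (free_cornering C) E (cm_h M) rec_v (@rec_cell)
    (cm_h_tens M) (cm_h_unit M) rec_v_app eq_refl _ _ _ _.
Next Obligation.
  cbn; intros; fc_start; rewrite ?rec_cellE.
  apply rec_hcomp.
Qed.
Next Obligation.
  cbn; intros; fc_start; rewrite ?rec_cellE.
  apply rec_vcomp.
Qed.
Next Obligation.
  cbn; intros; fc_start; rewrite ?rec_cellE.
  apply rec_hid.
Qed.
Next Obligation.
  cbn; intros; fc_start; rewrite ?rec_cellE.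
  reflexivity.
Qed.
End Rec.

Section FCGenerators.
Context {C : CartCategory}.
Notation F := (free_cornering C).

Definition ucirc (A : C) : VE F := [circ A].
Definition ubullet (A : C) : VE F := [bullet A].
Definition f_mor {A B : C} (f : hom A B) : @cell F munit A B munit := fc_cls (fc_mor f).
Definition f_getL (A : C) : @cell F (ucirc A) munit A munit := fc_cls (fc_getL A).
Definition f_putR (A : C) : @cell F munit A munit (ucirc A) := fc_cls (fc_putR A).
Definition f_getR (A : C) : @cell F munit munit A (ubullet A) := fc_cls (fc_getR A).
Definition f_putL (A : C) : @cell F (ubullet A) A munit munit := fc_cls (fc_putL A).
End FCGenerators.

Section FCCGenerators.
Context {C : DistCCCategory}.
Notation F := (free_cornering_choice C).
Implicit Types U V W : VE F.

Definition ccirc1 (A : C) : VE F := [ccirc A].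
Definition cbullet1 (A : C) : VE F := [cbullet A].
Definition vprod U W : VE F := [cprod U W].
Definition vsum U W : VE F := [csum U W].

Definition g_mor {A B : C} (f : hom A B) : @cell F munit A B munit := fcc_cls (fcc_mor f).
Definition g_getL (A : C) : @cell F (ccirc1 A) munit A munit := fcc_cls (fcc_getL A).
Definition g_putR (A : C) : @cell F munit A munit (ccirc1 A) := fcc_cls (fcc_putR A).
Definition g_getR (A : C) : @cell F munit munit A (cbullet1 A) := fcc_cls (fcc_getR A).
Definition g_putL (A : C) : @cell F (cbullet1 A) A munit munit := fcc_cls (fcc_putL A).

Definition g_pi0 U W : @cell F (vprod U W) munit munit U := fcc_cls (fcc_pi0 U W).
Definition g_pi1 U W : @cell F (vprod U W) munit munit W := fcc_cls (fcc_pi1 U W).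
Definition g_iota0 U W : @cell F U munit munit (vsum U W) := fcc_cls (fcc_iota0 U W).
Definition g_iota1 U W : @cell F W munit munit (vsum U W) := fcc_cls (fcc_iota1 U W).

Definition g_times {V U W} {A B : C} (α : @cell F V A B U) (β : @cell F V A B W) :
  @cell F V A B (vprod U W) := fcc_cls (fcc_times (repr α) (repr β)).
Definition g_plus {U V W} {A B : C} (α : @cell F U A B V) (β : @cell F W A B V) :
  @cell F (vsum U W) A B V := fcc_cls (fcc_plus (repr α) (repr β)).
Definition g_case {U W} {A B D : C} (α : @cell F U A D W) (β : @cell F U B D W) :
  @cell F U (A ⊕ B) D W := fcc_cls (fcc_case (repr α) (repr β)).

Lemma g_timesE V U W A B (x : fcc_term V A B U) (y : fcc_term V A B W) :
  g_times (fcc_cls x) (fcc_cls y) = fcc_cls (fcc_times x y).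
Proof. apply fcc_cls_eq, fcc_times_cong; apply (repr_cls (fcc_equiv_at _ _ _ _)). Qed.

Lemma g_plusE U V W A B (x : fcc_term U A B V) (y : fcc_term W A B V) :
  g_plus (fcc_cls x) (fcc_cls y) = fcc_cls (fcc_plus x y).
Proof. apply fcc_cls_eq, fcc_plus_cong; apply (repr_cls (fcc_equiv_at _ _ _ _)). Qed.

Lemma g_caseE U W A B D (x : fcc_term U A D W) (y : fcc_term U B D W) :
  g_case (fcc_cls x) (fcc_cls y) = fcc_cls (fcc_case x y).
Proof. apply fcc_cls_eq, fcc_case_cong; apply (repr_cls (fcc_equiv_at _ _ _ _)). Qed.
End FCCGenerators.

Program Definition incl_model (C : DistCCCategory) : CorneringModel C (free_cornering_choice C) :=
  @Build_CorneringModel C (free_cornering_choice C) (fun A => A)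
    (fun A B => eq_refl) eq_refl
    (fun p => match p with circ A => ccirc1 A | bullet A => cbullet1 A end)
    (@g_mor C) g_getL g_putR g_getR g_putL _ _ _ _ _ _ _.
Next Obligation.
  intros; cbn; unfold g_mor, g_getL, g_putR, g_getR, g_putL, ccirc1, cbullet1;
  rewrite ?fccq_hcompE, ?fccq_vcompE.
  f_equal. apply fcc_cls_eq, fcc_mor_comp.
Qed.
Next Obligation.
  intros; cbn; unfold g_mor, g_getL, g_putR, g_getR, g_putL, ccirc1, cbullet1;
  rewrite ?fccq_hcompE, ?fccq_vcompE.
  f_equal. apply fcc_cls_eq, fcc_mor_id.
Qed.
Next Obligation.
  intros; cbn; unfold g_mor, g_getL, g_putR, g_getR, g_putL, ccirc1, cbullet1;
  rewrite ?fccq_hcompE, ?fccq_vcompE.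
  f_equal. apply fcc_cls_eq, fcc_mor_tens.
Qed.
Next Obligation.
  intros; cbn; unfold g_mor, g_getL, g_putR, g_getR, g_putL, ccirc1, cbullet1;
  rewrite ?fccq_hcompE, ?fccq_vcompE.
  apply fcc_cls_sq; auto using tens1l, tens1r. apply fcc_putR_getL.
Qed.
Next Obligation.
  intros; cbn; unfold g_mor, g_getL, g_putR, g_getR, g_putL, ccirc1, cbullet1;
  rewrite ?fccq_hcompE, ?fccq_vcompE.
  apply fcc_cls_sq; auto. apply fcc_getL_putR.
Qed.
Next Obligation.
  intros; cbn; unfold g_mor, g_getL, g_putR, g_getR, g_putL, ccirc1, cbullet1;
  rewrite ?fccq_hcompE, ?fccq_vcompE.
  apply fcc_cls_sq; auto using tens1l, tens1r. apply fcc_getR_putL.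
Qed.
Next Obligation.
  intros; cbn; unfold g_mor, g_getL, g_putR, g_getR, g_putL, ccirc1, cbullet1;
  rewrite ?fccq_hcompE, ?fccq_vcompE.
  apply fcc_cls_sq; auto. apply fcc_getR_putL_v.
Qed.

Definition incl (C : DistCCCategory) :
  DoubleFunctor (free_cornering C) (free_cornering_choice C) := cornering_rec (incl_model C).

(* These values on generators determine [D]; existence is [is_D_exists]. *)
Record is_D {C : CCCategory} (D : DoubleFunctor (free_cornering C) (stateful C)) : Prop := {
  D_hmap : forall A : C, hmap D A = A;
  D_circ : forall A : C, vmap D (ucirc A) = circSF A;
  D_bullet : forall A : C, vmap D (ubullet A) = bulletSF A;
  D_mor : forall (A B : C) (f : hom A B), cmap D (f_mor f) ≋ s_mor f;
  D_getL : forall A : C, cmap D (f_getL A) ≋ s_getL A;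
  D_putR : forall A : C, cmap D (f_putR A) ≋ s_putR A;
  D_getR : forall A : C, cmap D (f_getR A) ≋ s_getR A;
  D_putL : forall A : C, cmap D (f_putL A) ≋ s_putL A
}.

Program Definition stateful_model (C : CCCategory) : CorneringModel C (stateful C) :=
  @Build_CorneringModel C (stateful C) (fun A => A)
    (fun A B => eq_refl) eq_refl
    (fun p => match p with circ A => circSF A | bullet A => bulletSF A end)
    (@s_mor C) s_getL s_putR s_getR s_putL _ _ _ _ _ _ _.
Next Obligation.
  intros; cbn in *.
  apply scell_eq; try reflexivity; try (symmetry; apply (mop1l (SF_monoid C))).
  intros X. apply eq_heq. cbn. now rewrite tensm_comp, comp_idl.
Qed.
Next Obligation.
  intros; cbn in *.
  f_equal. apply StrongNat_eq. intros X. cbn. apply tensm_id.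
Qed.
Next Obligation.
  intros; cbn in *.
  f_equal. apply StrongNat_eq. intros X. apply heq_eq.
  etransitivity; [|symmetry; apply (s_hcomp_heq (s_mor f) (s_mor g) X)].
  cbn. rewrite <- tensm_assoc. apply eq_heq.
  rewrite tensm_comp. now rewrite comp_idr, comp_idl.
Qed.
Next Obligation.
  intros; cbn in *.
  apply scell_eq; auto using tens1l, tens1r. intros X.
  rewrite s_hcomp_heq. cbn.
  transitivity (mkArrow (idm (X ⊗ A) ;; idm (X ⊗ A))); [|now rewrite comp_idl].
  apply comp_heq.
  + etransitivity; [apply tensm_unitr|apply hcast_heq].
  + rewrite hcast_heq. now rewrite tens1r.
Qed.
Next Obligation.
  intros; cbn in *.
  apply scell_eq; try reflexivity; try apply (mop1r (SF_monoid C)); try apply (mop1l (SF_monoid C)).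
  intros X. rewrite s_hid_heq. cbn.
  transitivity (mkArrow (idm (X ⊗ A) ;; idm (X ⊗ A))); [|now rewrite comp_idl].
  apply comp_heq; apply hcast_heq.
Qed.
Next Obligation.
  intros; cbn in *.
  apply scell_eq; auto using tens1l, tens1r. intros X.
  rewrite s_hcomp_heq. cbn.
  transitivity (mkArrow ((lam (idm (X ⊗ A)) ⊗₁ idm A) ;; ev (X ⊗ A) A)).
  { apply comp_heq; [apply tensm_heq; [apply hcast_heq|reflexivity]|].
    apply hcast_heq. }
  now rewrite lam_ev.
Qed.
Next Obligation.
  intros; cbn in *.
  apply scell_eq; try reflexivity; try apply (mop1r (SF_monoid C)); try apply (mop1l (SF_monoid C)).
  intros X. rewrite s_hid_heq. cbn.
  transitivity (mkArrow (lam (idm (expo X A ⊗ A)) ;; bullet_fmap A (ev X A))).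
  { apply comp_heq; [apply hcast_heq|].
    assert (K : forall (P Q R : C) (u : hom P Q) (v : hom P R), u ≡ v ->
              bullet_fmap A u ≡ bullet_fmap A v).
    { intros. heq_destruct. reflexivity. }
    apply K, hcast_heq. }
  apply eq_heq, lam_ext. rewrite tensm_compl, comp_assoc, bullet_fmap_ev, <- comp_assoc, lam_ev.
  now rewrite tensm_id, !comp_idl.
Qed.

Lemma is_D_exists (C : CCCategory) :
  exists D : DoubleFunctor (free_cornering C) (stateful C), is_D D.
Proof.
  exists (cornering_rec (stateful_model C)). split; intros; cbn;
    unfold f_mor, f_getL, f_putR, f_getR, f_putL; rewrite ?rec_cellE; try apply ccast_heq.
  - reflexivity.
  - apply (mop1r (SF_monoid C)).
  - apply (mop1r (SF_monoid C)).
  - reflexivity.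
Qed.

(* Main.v *)
(** The value of [D'] on vertical edges is forced by the generators, and its value on
    cells is defined by recursion on terms.  Soundness reduces to the universal
    properties of the cells α × β, α + β and [α, β] of stateful transformations, which
    hold componentwise: they are those of the product in C, of the coproduct [U X ⊕ W X]
    after distributing it over [- ⊗ A], and of the coproduct [A ⊕ B] after distributing
    it over [U X ⊗ -].  Finally [D'] restricts to [D] because a double functor out of
    the free cornering is determined by its values on generators. *)

From Stdlib Require Import List.
Require Import Defs.
Import ListNotations.

(** * Universal properties of products, sums and case cells among stateful transformations *)

Section ChoiceCells.
#[local] Set Implicit Arguments.
Context {C : DistCCCategory}.
Implicit Types U V W : StrongFunctor C.
Implicit Types A B X : C.
Notation scl := (@cell (stateful C)).

Lemma scomp_sq U A B W U' A' B' W' (α : scl U A B W) (β : scl U' A' B' W') X :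
  α ≋ β -> scomp α X ≡ scomp β X.
Proof. intros. sq_destruct. reflexivity. Qed.

(** A cell built by [unit_scell] has unit top and bottom, and tensoring with [idm tunit] is strictly
    the identity. Pasting it on the right is therefore postcomposition of components, so projections
    act on [s_times] as in [C]. *)
Lemma scomp_hcomp_unit_scell U A B V W (α : scl U A B V) (a : StrongNat V W) X :
  scomp (s_hcomp α (unit_scell a)) X ≡ scomp α X ;; a (X ⊗ B).
Proof.
  rewrite s_hcomp_heq. apply comp_heq; [apply tensm_unitr | apply hcast_heq].
Qed.

(** On the left the top edge [A] of [α] is carried along. Injections thus appear as [s0 ⊗₁ idm A]
    and [s1 ⊗₁ idm A], the form that [distr] inverts. *)
Lemma scomp_unit_scell_hcomp U A B V W (a : StrongNat U V) (α : scl V A B W) X :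
  scomp (s_hcomp (unit_scell a) α) X ≡ (a X ⊗₁ idm A) ;; scomp α X.
Proof.
  rewrite s_hcomp_heq. apply comp_heq.
  - apply tensm_heq; [apply hcast_heq | reflexivity].
  - apply scomp_heq, tens1r.
Qed.

Lemma s_times_pi0 V A B U W (α : scl V A B U) (β : scl V A B W) :
  (s_hcomp (s_times α β) (s_pi0 U W) : scl _ _ _ _) ≋ α.
Proof.
  apply scell_eq; auto using tens1r. intros X.
  etransitivity; [apply scomp_hcomp_unit_scell|]. apply eq_heq, pairing_p0.
Qed.

Lemma s_times_pi1 V A B U W (α : scl V A B U) (β : scl V A B W) :
  (s_hcomp (s_times α β) (s_pi1 U W) : scl _ _ _ _) ≋ β.
Proof.
  apply scell_eq; auto using tens1r. intros X.
  etransitivity; [apply scomp_hcomp_unit_scell|]. apply eq_heq, pairing_p1.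
Qed.

(** A strong natural transformation is determined by its components, so uniqueness of pairing in [C]
    suffices at each [X]. *)
Lemma s_times_uniq V A B U W (α : scl V A B U) (β : scl V A B W)
  (γ : scl V A B (prodSF U W)) :
  (s_hcomp γ (s_pi0 U W) : scl _ _ _ _) ≋ α ->
  (s_hcomp γ (s_pi1 U W) : scl _ _ _ _) ≋ β -> γ = s_times α β.
Proof.
  intros H0 H1. apply StrongNat_eq. intros X. apply pairing_unique; apply heq_eq.
  - exact (eq_trans (eq_sym (scomp_hcomp_unit_scell _ _ _)) (scomp_sq X H0)).
  - exact (eq_trans (eq_sym (scomp_hcomp_unit_scell _ _ _)) (scomp_sq X H1)).
Qed.

Lemma s_iota0_plus U A B V W (α : scl U A B V) (β : scl W A B V) :
  (s_hcomp (s_iota0 U W) (s_plus α β) : scl _ _ _ _) ≋ α.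
Proof.
  apply scell_eq; auto using tens1l. intros X.
  etransitivity; [apply scomp_unit_scell_hcomp|].
  apply eq_heq. cbn. now rewrite <- comp_assoc, s0_distr, copairing_s0.
Qed.

Lemma s_iota1_plus U A B V W (α : scl U A B V) (β : scl W A B V) :
  (s_hcomp (s_iota1 U W) (s_plus α β) : scl _ _ _ _) ≋ β.
Proof.
  apply scell_eq; auto using tens1l. intros X.
  etransitivity; [apply scomp_unit_scell_hcomp|].
  apply eq_heq. cbn. now rewrite <- comp_assoc, s1_distr, copairing_s1.
Qed.

(** By distributivity a map out of [(U X ⊕ W X) ⊗ A] is determined by its restrictions along the two
    injections tensored with [A]. Those restrictions are the components of the composites with
    [s_iota0] and [s_iota1]. *)
Lemma s_plus_uniq U A B V W (α : scl U A B V) (β : scl W A B V)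
  (γ : scl (sumSF U W) A B V) :
  (s_hcomp (s_iota0 U W) γ : scl _ _ _ _) ≋ α ->
  (s_hcomp (s_iota1 U W) γ : scl _ _ _ _) ≋ β -> γ = s_plus α β.
Proof.
  intros H0 H1. apply StrongNat_eq. intros X. apply distr_ext; apply heq_eq.
  - refine (eq_trans (eq_sym (scomp_unit_scell_hcomp _ γ _)) (eq_trans (scomp_sq X H0) _)).
    exact (eq_trans (eq_sym (scomp_sq X (s_iota0_plus α β))) (scomp_unit_scell_hcomp _ _ _)).
  - refine (eq_trans (eq_sym (scomp_unit_scell_hcomp _ γ _)) (eq_trans (scomp_sq X H1) _)).
    exact (eq_trans (eq_sym (scomp_sq X (s_iota1_plus α β))) (scomp_unit_scell_hcomp _ _ _)).
Qed.

Lemma s_s0_case U A B X W (α : scl U A X W) (β : scl U B X W) :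
  (s_vcomp (s_mor (s0 A B)) (s_case α β) : scl _ _ _ _) ≋ α.
Proof.
  apply scell_eq; auto; try apply (mop1l (SF_monoid C)). intros Y.
  apply eq_heq. cbn. now rewrite <- comp_assoc, s0_distl, copairing_s0.
Qed.

Lemma s_s1_case U A B X W (α : scl U A X W) (β : scl U B X W) :
  (s_vcomp (s_mor (s1 A B)) (s_case α β) : scl _ _ _ _) ≋ β.
Proof.
  apply scell_eq; auto; try apply (mop1l (SF_monoid C)). intros Y.
  apply eq_heq. cbn. now rewrite <- comp_assoc, s1_distl, copairing_s1.
Qed.

(** The component of the vertical composite with [s_mor (s0 A B)] is, up to conversion,
    precomposition with [idm (U Y) ⊗₁ s0 A B], and likewise for [s1]. Left distributivity makes
    these two restrictions jointly determine [γ]. *)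
Lemma s_case_uniq U A B X W (α : scl U A X W) (β : scl U B X W)
  (γ : scl U (A ⊕ B) X W) :
  (s_vcomp (s_mor (s0 A B)) γ : scl _ _ _ _) ≋ α ->
  (s_vcomp (s_mor (s1 A B)) γ : scl _ _ _ _) ≋ β -> γ = s_case α β.
Proof.
  intros H0 H1. apply StrongNat_eq. intros Y. apply distl_ext; apply heq_eq.
  - exact (eq_trans (scomp_sq Y H0) (eq_sym (scomp_sq Y (s_s0_case α β)))).
  - exact (eq_trans (scomp_sq Y H1) (eq_sym (scomp_sq Y (s_s1_case α β)))).
Qed.

Lemma s_times_sq V A B U W V' A' B' U' W' (α : scl V A B U) (β : scl V A B W)
  (α' : scl V' A' B' U') (β' : scl V' A' B' W') : α ≋ α' -> β ≋ β' ->
  (s_times α β : scl _ _ _ _) ≋ (s_times α' β' : scl _ _ _ _).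
Proof. intros. sq_destruct. reflexivity. Qed.

Lemma s_plus_sq U A B V W U' A' B' V' W' (α : scl U A B V) (β : scl W A B V)
  (α' : scl U' A' B' V') (β' : scl W' A' B' V') : α ≋ α' -> β ≋ β' ->
  (s_plus α β : scl _ _ _ _) ≋ (s_plus α' β' : scl _ _ _ _).
Proof. intros. sq_destruct. reflexivity. Qed.

Lemma s_case_sq U A B X W U' A' B' X' W' (α : scl U A X W) (β : scl U B X W)
  (α' : scl U' A' X' W') (β' : scl U' B' X' W') : α ≋ α' -> β ≋ β' ->
  (s_case α β : scl _ _ _ _) ≋ (s_case α' β' : scl _ _ _ _).
Proof. intros. sq_destruct. reflexivity. Qed.
End ChoiceCells.

(** * The extended double functor, by recursion on terms *)

Section ChoiceRec.
#[local] Set Implicit Arguments.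
Context {C : DistCCCategory}.
Notation scl := (@cell (stateful C)).

(** Both folds are [choice_v], written out because that function is itself defined from this one. *)
Fixpoint cport_SF (p : cport C) : StrongFunctor C :=
  match p with
  | ccirc A => circSF A
  | cbullet A => bulletSF A
  | cprod U W =>
      prodSF (fold_right (fun q F => compSF (cport_SF q) F) (idSF C) U)
             (fold_right (fun q F => compSF (cport_SF q) F) (idSF C) W)
  | csum U W =>
      sumSF (fold_right (fun q F => compSF (cport_SF q) F) (idSF C) U)
            (fold_right (fun q F => compSF (cport_SF q) F) (idSF C) W)
  end.

Definition choice_v (U : list (cport C)) : VE (stateful C) :=
  fold_right (fun q F => compSF (cport_SF q) F) (idSF C) U.

Lemma choice_v_app U W : choice_v (U ++ W) = mop (choice_v U) (choice_v W).
Proof.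
  induction U as [|p U IH]; simpl; [symmetry; apply (mop1l (SF_monoid C))|].
  rewrite IH. symmetry. apply (mopA (SF_monoid C)).
Qed.

(** A one-letter word is sent to a composite with [idSF C], which equals the functor of its letter
    only propositionally. This is the source of the casts on generators below. *)
Lemma choice_v1 p : cport_SF p = choice_v [p].
Proof. symmetry. apply (mop1r (SF_monoid C)). Qed.

(** Since horizontal edges are fixed, only vertical boundaries need casts: along [choice_v_app] for
    vertical composites and along [choice_v1] for one-letter words. *)
Fixpoint choice_term {U A B W} (x : @fcc_term C U A B W) :
  scl (choice_v U) A B (choice_v W) :=
  match x in fcc_term u a b w return scl (choice_v u) a b (choice_v w) with
  | fcc_hid U => s_hid (choice_v U)
  | fcc_vid A => s_vid A
  | fcc_hcomp x y => s_hcomp (choice_term x) (choice_term y)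
  | @fcc_vcomp _ U A D W U' B W' x y =>
      ccast (eq_sym (choice_v_app U U')) eq_refl eq_refl (eq_sym (choice_v_app W W'))
        (vcomp (choice_term x) (choice_term y))
  | fcc_mor f => s_mor f
  | fcc_getL A => ccast (cell := scl) (choice_v1 (ccirc A)) eq_refl eq_refl eq_refl (s_getL A)
  | fcc_putR A => ccast (cell := scl) eq_refl eq_refl eq_refl (choice_v1 (ccirc A)) (s_putR A)
  | fcc_getR A => ccast (cell := scl) eq_refl eq_refl eq_refl (choice_v1 (cbullet A)) (s_getR A)
  | fcc_putL A => ccast (cell := scl) (choice_v1 (cbullet A)) eq_refl eq_refl eq_refl (s_putL A)
  | fcc_pi0 U W => ccast (cell := scl) (choice_v1 (cprod U W)) eq_refl eq_refl eq_refl
      (s_pi0 (choice_v U) (choice_v W))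
  | fcc_pi1 U W => ccast (cell := scl) (choice_v1 (cprod U W)) eq_refl eq_refl eq_refl
      (s_pi1 (choice_v U) (choice_v W))
  | @fcc_times _ V A B U W x y =>
      ccast (cell := scl) eq_refl eq_refl eq_refl (choice_v1 (cprod U W))
        (s_times (choice_term x) (choice_term y))
  | fcc_iota0 U W => ccast (cell := scl) eq_refl eq_refl eq_refl (choice_v1 (csum U W))
      (s_iota0 (choice_v U) (choice_v W))
  | fcc_iota1 U W => ccast (cell := scl) eq_refl eq_refl eq_refl (choice_v1 (csum U W))
      (s_iota1 (choice_v U) (choice_v W))
  | @fcc_plus _ U A B V W x y =>
      ccast (cell := scl) (choice_v1 (csum U W)) eq_refl eq_refl eq_refl
        (s_plus (choice_term x) (choice_term y))
  | fcc_case x y => s_case (choice_term x) (choice_term y)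
  end.

Lemma choice_term_hcomp U A B V A' B' W (x : @fcc_term C U A B V) (y : @fcc_term C V A' B' W) :
  choice_term (fcc_hcomp x y) ≋ hcomp (choice_term x) (choice_term y).
Proof. reflexivity. Qed.

Lemma choice_term_vcomp U A D W U' B W' (x : @fcc_term C U A D W) (y : @fcc_term C U' D B W') :
  choice_term (fcc_vcomp x y) ≋ vcomp (choice_term x) (choice_term y).
Proof. apply ccast_heq. Qed.

Lemma choice_term_times V A B U W (x : @fcc_term C V A B U) (y : @fcc_term C V A B W) :
  choice_term (fcc_times x y) ≋ (s_times (choice_term x) (choice_term y) : scl _ _ _ _).
Proof. apply ccast_heq. Qed.

Lemma choice_term_plus U A B V W (x : @fcc_term C U A B V) (y : @fcc_term C W A B V) :
  choice_term (fcc_plus x y) ≋ (s_plus (choice_term x) (choice_term y) : scl _ _ _ _).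
Proof. apply ccast_heq. Qed.

(** Transporting [choice_term z] along [choice_v1] gives a cell [γ] whose right boundary is
    literally a [prodSF], to which [s_times_uniq] applies. The transport is invisible to [≋]. *)
Lemma choice_term_times_uniq V A B U W (x : @fcc_term C V A B U) (y : @fcc_term C V A B W)
  (z : @fcc_term C V A B [cprod U W]) :
  choice_term (fcc_hcomp z (fcc_pi0 U W)) ≋ choice_term x ->
  choice_term (fcc_hcomp z (fcc_pi1 U W)) ≋ choice_term y ->
  choice_term z ≋ choice_term (fcc_times x y).
Proof.
  intros H0 H1.
  set (γ := ccast (cell := scl) eq_refl eq_refl eq_refl
              (eq_sym (choice_v1 (cprod U W))) (choice_term z)).
  assert (Hγ : γ ≋ choice_term z) by apply ccast_heq.
  rewrite <- Hγ, choice_term_times.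
  apply f_equal, s_times_uniq.
  - refine (eq_trans _ H0). apply (hcomp_sq (E := stateful C)); [exact Hγ | symmetry; apply ccast_heq].
  - refine (eq_trans _ H1). apply (hcomp_sq (E := stateful C)); [exact Hγ | symmetry; apply ccast_heq].
Qed.

Lemma choice_term_plus_uniq U A B V W (x : @fcc_term C U A B V) (y : @fcc_term C W A B V)
  (z : @fcc_term C [csum U W] A B V) :
  choice_term (fcc_hcomp (fcc_iota0 U W) z) ≋ choice_term x ->
  choice_term (fcc_hcomp (fcc_iota1 U W) z) ≋ choice_term y ->
  choice_term z ≋ choice_term (fcc_plus x y).
Proof.
  intros H0 H1.
  set (γ := ccast (cell := scl) (eq_sym (choice_v1 (csum U W))) eq_refl eq_refl
              eq_refl (choice_term z)).
  assert (Hγ : γ ≋ choice_term z) by apply ccast_heq.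
  rewrite <- Hγ, choice_term_plus.
  apply f_equal, s_plus_uniq.
  - refine (eq_trans _ H0). apply (hcomp_sq (E := stateful C)); [symmetry; apply ccast_heq | exact Hγ].
  - refine (eq_trans _ H1). apply (hcomp_sq (E := stateful C)); [symmetry; apply ccast_heq | exact Hγ].
Qed.

(** Induction on derivations, so that the uniqueness rules receive their premises already
    interpreted. The double category laws hold in [stateful C], the equations for morphisms and
    corners come from [stateful_model C], and the choice rules are the universal properties
    above. *)
Lemma choice_sound s t : fcc_eq s t ->
  mkSquare (choice_term (sq_cell s)) = mkSquare (choice_term (sq_cell t)).
Proof.
  induction 1; cbn [sq_cell sq_left sq_top sq_bot sq_right] in *.
  - reflexivity.
  - now symmetry.
  - now etransitivity; eauto.
  - now apply (hcomp_sq (E := stateful C)).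
  - rewrite !choice_term_vcomp. now apply (vcomp_sq (E := stateful C)).
  - rewrite !choice_term_times. now apply s_times_sq.
  - rewrite !choice_term_plus. now apply s_plus_sq.
  - now apply s_case_sq.
  - apply (hcompA (stateful C)).
  - apply (hcomp1l (stateful C)).
  - apply (hcomp1r (stateful C)).
  - rewrite !choice_term_vcomp.
    etransitivity; [apply (vcomp_sq (E := stateful C)); [apply choice_term_vcomp|reflexivity]|].
    rewrite vcompA. symmetry. apply (vcomp_sq (E := stateful C)); [reflexivity|apply choice_term_vcomp].
  - rewrite choice_term_vcomp. apply vcomp1l.
  - rewrite choice_term_vcomp. apply vcomp1r.
  - apply f_equal, (hid_unit (stateful C)).
  - apply f_equal, (vid_mop (stateful C)).
  (* This is the rule [fcc_hid_app]: the interpretation of a concatenated word splits by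
     [choice_v_app] before [hid_mop] applies. *)
  - rewrite choice_term_vcomp.
    etransitivity; [apply (hid_sq (E := stateful C)), choice_v_app|].
    apply f_equal, (hid_mop (stateful C)).
  - rewrite choice_term_vcomp, choice_term_hcomp.
    etransitivity; [apply f_equal, (interchange (stateful C))|].
    symmetry. apply (hcomp_sq (E := stateful C)); apply choice_term_vcomp.
  - rewrite choice_term_vcomp. apply (cm_mor_comp (stateful_model C)).
  - apply (cm_mor_id (stateful_model C)).
  - apply (cm_mor_tens (stateful_model C)).
  - etransitivity; [apply (hcomp_sq (E := stateful C)); apply ccast_heq|].
    apply (cm_putR_getL (stateful_model C)).
  - rewrite choice_term_vcomp. etransitivity; [apply (vcomp_sq (E := stateful C)); apply ccast_heq|].
    etransitivity; [apply (cm_getL_putR (stateful_model C))|].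
    apply (hid_sq (E := stateful C)), (choice_v1 (ccirc A)).
  - etransitivity; [apply (hcomp_sq (E := stateful C)); apply ccast_heq|].
    apply (cm_getR_putL (stateful_model C)).
  - rewrite choice_term_vcomp. etransitivity; [apply (vcomp_sq (E := stateful C)); apply ccast_heq|].
    etransitivity; [apply (cm_getR_putL_v (stateful_model C))|].
    apply (hid_sq (E := stateful C)), (choice_v1 (cbullet A)).
  - etransitivity; [apply (hcomp_sq (E := stateful C)); apply ccast_heq|]. apply s_times_pi0.
  - etransitivity; [apply (hcomp_sq (E := stateful C)); apply ccast_heq|]. apply s_times_pi1.
  - now apply choice_term_times_uniq.
  - etransitivity; [apply (hcomp_sq (E := stateful C)); apply ccast_heq|]. apply s_iota0_plus.
  - etransitivity; [apply (hcomp_sq (E := stateful C)); apply ccast_heq|]. apply s_iota1_plus.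
  - now apply choice_term_plus_uniq.
  - rewrite choice_term_vcomp. apply s_s0_case.
  - rewrite choice_term_vcomp. apply s_s1_case.
  - rewrite choice_term_vcomp in *. apply f_equal. now apply s_case_uniq.
Qed.

Definition choice_cell {U A B W} (α : @fcc_cell C U A B W) :
  scl (choice_v U) A B (choice_v W) := choice_term (repr α).

(** The representative chosen by [repr] is related to [x], so soundness gives them the same
    interpretation. *)
Lemma choice_cellE U A B W (x : @fcc_term C U A B W) : choice_cell (fcc_cls x) = choice_term x.
Proof. apply sq_eq, (choice_sound (repr_cls (fcc_equiv_at U A B W) x)). Qed.

Lemma choice_cell_hcomp U A B V A' B' W (α : @fcc_cell C U A B V) (β : @fcc_cell C V A' B' W) :
  choice_cell (fccq_hcomp α β) ≋ hcomp (choice_cell α) (choice_cell β).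
Proof. fcc_start. rewrite !choice_cellE. reflexivity. Qed.

Lemma choice_cell_vcomp U A D W U' B W' (α : @fcc_cell C U A D W) (β : @fcc_cell C U' D B W') :
  choice_cell (fccq_vcomp α β) ≋ vcomp (choice_cell α) (choice_cell β).
Proof. fcc_start. rewrite !choice_cellE. apply choice_term_vcomp. Qed.

Lemma choice_cell_hid U : choice_cell (fcc_cls (fcc_hid U)) ≋ (s_hid (choice_v U) : scl _ _ _ _).
Proof. now rewrite choice_cellE. Qed.

Lemma choice_cell_vid A : choice_cell (fcc_cls (fcc_vid A)) ≋ (s_vid A : scl _ _ _ _).
Proof. now rewrite choice_cellE. Qed.

Definition choice_rec : DoubleFunctor (free_cornering_choice C) (stateful C) :=
  @Build_DoubleFunctor (free_cornering_choice C) (stateful C) (fun A => A) choice_v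
    (@choice_cell) (fun A B => eq_refl) eq_refl choice_v_app eq_refl
    choice_cell_hcomp choice_cell_vcomp choice_cell_hid choice_cell_vid.
End ChoiceRec.

(** * Double functors out of the free cornering are determined by generators *)

(** Vertical edges are words in the generating ports and every cell is the class of a term, so
    preservation of units and composites propagates agreement by induction on words and then on
    terms. *)
Lemma free_cornering_ext (C : CartCategory) (E : DoubleCategory)
  (F G : DoubleFunctor (free_cornering C) E) :
  (forall A, hmap F A = hmap G A) ->
  (forall A, vmap F (ucirc A) = vmap G (ucirc A)) ->
  (forall A, vmap F (ubullet A) = vmap G (ubullet A)) ->
  (forall A B (f : hom A B), cmap F (f_mor f) ≋ cmap G (f_mor f)) ->
  (forall A, cmap F (f_getL A) ≋ cmap G (f_getL A)) ->
  (forall A, cmap F (f_putR A) ≋ cmap G (f_putR A)) ->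
  (forall A, cmap F (f_getR A) ≋ cmap G (f_getR A)) ->
  (forall A, cmap F (f_putL A) ≋ cmap G (f_putL A)) -> F = G.
Proof.
  intros Hh Hc Hb Hmor HgL HpR HgR HpL.
  assert (Hv : forall U, vmap F U = vmap G U).
  { induction U as [|p U IH].
    - etransitivity; [apply (vmap_munit F)|symmetry; apply (vmap_munit G)].
    (* Reading [p :: U] as the product of [[p]] with [U] exposes the form to which [vmap_mop]
       applies. *)
    - change (vmap F (@mop (VE (free_cornering C)) [p] U)
              = vmap G (@mop (VE (free_cornering C)) [p] U)).
      rewrite !vmap_mop, IH. f_equal. destruct p; [apply Hc|apply Hb]. }
  apply DoubleFunctor_eq; auto.
  intros U A B W α. revert α. apply fc_ind. intros x.
  induction x.
  - etransitivity; [apply (cmap_hid F)|]. rewrite Hv. symmetry. apply (cmap_hid G).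
  - etransitivity; [apply (cmap_vid F)|]. rewrite Hh. symmetry. apply (cmap_vid G).
  - rewrite <- fcq_hcompE. etransitivity; [apply (cmap_hcomp F)|].
    etransitivity; [apply hcomp_sq; eassumption|]. symmetry. apply (cmap_hcomp G).
  - rewrite <- fcq_vcompE. etransitivity; [apply (cmap_vcomp F)|].
    etransitivity; [apply vcomp_sq; eassumption|]. symmetry. apply (cmap_vcomp G).
  - apply Hmor.
  - apply HgL.
  - apply HpR.
  - apply HgR.
  - apply HpL.
Qed.

(** * The inclusion of the free cornering on generating cells *)

Section Inclusion.
Context {C : DistCCCategory}.

Lemma incl_mor (A B : C) (f : hom A B) : cmap (incl C) (f_mor f) ≋ g_mor f.
Proof. cbn. unfold f_mor. now rewrite rec_cellE. Qed.

Lemma incl_getL (A : C) : cmap (incl C) (f_getL A) ≋ g_getL A.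
Proof. cbn. unfold f_getL. rewrite rec_cellE. apply ccast_heq. Qed.

Lemma incl_putR (A : C) : cmap (incl C) (f_putR A) ≋ g_putR A.
Proof. cbn. unfold f_putR. rewrite rec_cellE. apply ccast_heq. Qed.

Lemma incl_getR (A : C) : cmap (incl C) (f_getR A) ≋ g_getR A.
Proof. cbn. unfold f_getR. rewrite rec_cellE. apply ccast_heq. Qed.

Lemma incl_putL (A : C) : cmap (incl C) (f_putL A) ≋ g_putL A.
Proof. cbn. unfold f_putL. rewrite rec_cellE. apply ccast_heq. Qed.
End Inclusion.

(** * Extension of [D] to the free cornering with choice *)

Theorem lemma16 (C : DistCCCategory)
  (D : DoubleFunctor (free_cornering C) (stateful C)) (hD : is_D D) :
  exists D' : DoubleFunctor (free_cornering_choice C) (stateful C),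
    compDF (incl C) D' = D /\
    (forall U W : VE (free_cornering_choice C),
      vmap D' (vsum U W) = sumSF (vmap D' U) (vmap D' W)) /\
    (forall U W : VE (free_cornering_choice C),
      vmap D' (vprod U W) = prodSF (vmap D' U) (vmap D' W)) /\
    (forall U W : VE (free_cornering_choice C),
      cmap D' (g_pi0 U W) ≋ s_pi0 (vmap D' U) (vmap D' W)) /\
    (forall U W : VE (free_cornering_choice C),
      cmap D' (g_pi1 U W) ≋ s_pi1 (vmap D' U) (vmap D' W)) /\
    (forall U W : VE (free_cornering_choice C),
      cmap D' (g_iota0 U W) ≋ s_iota0 (vmap D' U) (vmap D' W)) /\
    (forall U W : VE (free_cornering_choice C),
      cmap D' (g_iota1 U W) ≋ s_iota1 (vmap D' U) (vmap D' W)) /\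
    (forall (U W : VE (free_cornering_choice C)) (A B X : C)
        (α : @cell (free_cornering_choice C) U A X W)
        (β : @cell (free_cornering_choice C) U B X W),
      cmap D' (g_case α β) ≋ s_case (cmap D' α) (cmap D' β)) /\
    (forall (U V W : VE (free_cornering_choice C)) (A B : C)
        (α : @cell (free_cornering_choice C) U A B V)
        (β : @cell (free_cornering_choice C) W A B V),
      cmap D' (g_plus α β) ≋ s_plus (cmap D' α) (cmap D' β)) /\
    (forall (U V W : VE (free_cornering_choice C)) (A B : C)
        (α : @cell (free_cornering_choice C) V A B U)
        (β : @cell (free_cornering_choice C) V A B W),
      cmap D' (g_times α β) ≋ s_times (cmap D' α) (cmap D' β)).
Proof.
  (* The witness is built without reference to [D], because [is_D] fixes the values of [D] on all
     generators. *)
  exists choice_rec. split; [|repeat split; intros].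
  - destruct hD. apply free_cornering_ext; intros.
    + now rewrite D_hmap.
    (* The left side is [circSF A] composed with [idSF C], as the image of a one-letter word. *)
    + rewrite D_circ. apply (mop1r (SF_monoid C)).
    + rewrite D_bullet. apply (mop1r (SF_monoid C)).
    + rewrite D_mor. refine (eq_trans (cmap_sq choice_rec (incl_mor _ _ f)) _).
      cbn. unfold g_mor. now rewrite choice_cellE.
    + rewrite D_getL. refine (eq_trans (cmap_sq choice_rec (incl_getL A)) _).
      cbn. unfold g_getL. rewrite choice_cellE. apply ccast_heq.
    + rewrite D_putR. refine (eq_trans (cmap_sq choice_rec (incl_putR A)) _).
      cbn. unfold g_putR. rewrite choice_cellE. apply ccast_heq.
    + rewrite D_getR. refine (eq_trans (cmap_sq choice_rec (incl_getR A)) _).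
      cbn. unfold g_getR. rewrite choice_cellE. apply ccast_heq.
    + rewrite D_putL. refine (eq_trans (cmap_sq choice_rec (incl_putL A)) _).
      cbn. unfold g_putL. rewrite choice_cellE. apply ccast_heq.
  - apply (mop1r (SF_monoid C)).
  - apply (mop1r (SF_monoid C)).
  - cbn. unfold g_pi0. rewrite choice_cellE. apply ccast_heq.
  - cbn. unfold g_pi1. rewrite choice_cellE. apply ccast_heq.
  - cbn. unfold g_iota0. rewrite choice_cellE. apply ccast_heq.
  - cbn. unfold g_iota1. rewrite choice_cellE. apply ccast_heq.
  (* The operations on classes are defined through representatives; writing both arguments as
     classes of terms lets [g_caseE] and [choice_cellE] compute. *)
  - cbn. revert α β. refine (fcc_ind _ _); intros x. refine (fcc_ind _ _); intros y.
    rewrite g_caseE, !choice_cellE. reflexivity.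
  - cbn. revert α β. refine (fcc_ind _ _); intros x. refine (fcc_ind _ _); intros y.
    rewrite g_plusE, !choice_cellE. apply ccast_heq.
  - cbn. revert α β. refine (fcc_ind _ _); intros x. refine (fcc_ind _ _); intros y.
    rewrite g_timesE, !choice_cellE. apply ccast_heq.
Qed.
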